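(* Let $1\le p<2$. There are spectral measures $E_1$, $E_2$ and $E_3$ on Borel subsets of $\mathbb R$, a function $\Phi$ in the Haagerup tensor product $L^\infty(E_1)\otimes_{\rm h}L^\infty(E_2)\otimes_{\rm h}L^\infty(E_3)$ and an operator $Q$ in $\boldsymbol S_p$ such that $$\iiint\Phi(x_1,x_2,x_3)\,dE_1(x_1)\,dE_2(x_2)\,Q\,dE_3(x_3)\notin\boldsymbol S_p.$$
   Context: $\boldsymbol S_p$ is the Schatten--von Neumann class. $\mathcal B$ is the space of matrices inducing bounded operators on $\ell^2$, with operator norm; $L^\infty_E(\ell^2)$ and $L^\infty_E(\mathcal B)$ are the spaces of $E$-essentially bounded measurable $\ell^2$-valued, resp. $\mathcal B$-valued (entrywise measurable), functions. $\sum_{j,k\ge0}$ means $\lim_{M,N\to\infty}\sum_{j=0}^N\sum_{k=0}^M$. $L^\infty(E_1)\otimes_{\rm h}L^\infty(E_2)\otimes_{\rm h}L^\infty(E_3)$ is the space of functions $\Phi(x_1,x_2,x_3)=\sum_{j,k\ge0}\alpha_j(x_1)\beta_{jk}(x_2)\gamma_k(x_3)$ with $\{\alpha_j\}\in L^\infty_{E_1}(\ell^2)$, $\{\beta_{jk}\}\in L^\infty_{E_2}(\mathcal B)$, $\{\gamma_k\}\in L^\infty_{E_3}(\ell^2)$. For such $\Phi$ and bounded $T,R$, $\iiint\Phi\,dE_1\,T\,dE_2\,R\,dE_3:=\sum_{j,k\ge0}(\int\alpha_j\,dE_1)T(\int\beta_{jk}\,dE_2)R(\int\gamma_k\,dE_3)$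 (weak operator convergence; independent of the representation). In the claim $T=I$ and $R=Q$. *)

(* Defs.v *)
From HB Require Import structures.
From mathcomp Require Import all_boot all_order all_algebra.
From mathcomp Require Import sesquilinear.
From mathcomp Require Import all_classical all_reals all_analysis.
From mathcomp.real_closed Require Import complex.

Set Implicit Arguments.
Unset Strict Implicit.
Unset Printing Implicit Defensive.

Import Order.TTheory GRing.Theory Num.Theory.
Import numFieldNormedType.Exports.

Local Open Scope classical_set_scope.
Local Open Scope ring_scope.

(* MathComp-Analysis does not equip the concrete type [R[i]] with its usual
   (modulus) topology; it is transported from the regular module. *)
#[non_forgetful_inheritance]
HB.instance Definition _ (R : realType) := NormedModule.copy R[i] R[i]^o.

(* Norms over [R[i]] take their values in [R[i]]; [rnorm] is the real value. *)
Definition rnorm (R : realType) (V : normedModType R[i]) (x : V) : R :=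
  complex.Re `|x|.

Record hilbertType (R : realType) := HilbertType {
  hcarrier :> completeNormedModType R[i];
  (* linear in the first argument, conjugate-linear in the second *)
  dotp : {dot hcarrier for (@Num.conj R[i])};
  hnormE : forall x : hcarrier, `|x| ^+ 2 = dotp x x
}.

Record boundedOp (R : realType) (H : hilbertType R) := BoundedOp {
  opfun :> {linear H -> H};
  opfunP : exists c : R, forall u : H, rnorm (opfun u) <= c * rnorm u
}.

Lemma idop_bounded (R : realType) (H : hilbertType R) :
  exists c : R, forall u : H, rnorm (idfun u) <= c * rnorm u.
Proof. by exists 1 => u; rewrite mul1r. Qed.

Definition idop (R : realType) (H : hilbertType R) : boundedOp H :=
  @BoundedOp R H idfun (@idop_bounded R H).

Section schatten.
Context (R : realType) (H : hilbertType R).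

Definition opnorm (f : H -> H) : R :=
  sup [set rnorm (f u) | u in [set u : H | rnorm u <= 1]].

Definition rank_le (n : nat) (K : boundedOp H) : Prop :=
  exists e : 'I_n -> H, forall u : H,
    exists c : 'I_n -> R[i], K u = \sum_(i < n) c i *: e i.

(* s_n(T) = inf { ||T - K|| : rank K <= n } *)
Definition singular_value (T : boundedOp H) (n : nat) : R :=
  inf [set opnorm (fun u => T u - K u) | K in rank_le n].

Definition schatten (p : R) (T : boundedOp H) : Prop :=
  (\sum_(0 <= n <oo) ((singular_value T n) `^ p)%:E < +oo)%E.

End schatten.

Record spectralMeasure (R : realType) (H : hilbertType R) := SpectralMeasure {
  spm :> set R -> boundedOp H;
  spm_idem : forall A : set R, measurable A ->
    forall u, spm A (spm A u) = spm A u;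
  spm_selfadjoint : forall A : set R, measurable A ->
    forall u v, dotp H (spm A u) v = dotp H u (spm A v);
  spm_setT : forall u, spm setT u = u;
  spm_sigma_additive : forall F : (set R)^nat,
    (forall n, measurable (F n)) -> trivIset setT F ->
    forall u, series (fun n => spm (F n) u) @ \oo --> spm (\bigcup_n F n) u
}.

Section triple_operator_integral.
Context (R : realType) (H : hilbertType R).
Implicit Type E : spectralMeasure H.

Definition spm_null E (N : set R) : Prop :=
  measurable N /\ forall u : H, E N u = 0.

Definition spm_ae E (P : set R) : Prop :=
  exists N : set R, spm_null E N /\ ~` N `<=` P.

(* the measure A |-> (E(A) u, u) = ||E(A) u||^2 *)
Definition scalar_measure E (u : H) : set R -> \bar R :=
  fun A => ((rnorm (E A u)) ^+ 2)%:E.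

Definition cmeasurable (f : R -> R[i]) : Prop :=
  measurable_fun setT (fun x => complex.Re (f x)) /\
  measurable_fun setT (fun x => complex.Im (f x)).

(* S is the operator [\int f dE], characterized by its quadratic form
   (S u, u) = \int f(x) (E(dx) u, u); the equalities in [\bar R] also assert
   that the integrals are finite. *)
Definition is_spectral_integral E (f : R -> R[i]) (S : boundedOp H) : Prop :=
  forall u : H,
    (complex.Re (dotp H (S u) u))%:E =
      (\int[scalar_measure E u]_x (complex.Re (f x))%:E)%E /\
    (complex.Im (dotp H (S u) u))%:E =
      (\int[scalar_measure E u]_x (complex.Im (f x))%:E)%E.

Definition l2norm2 (a : nat -> R[i]) : \bar R :=
  (\sum_(0 <= k <oo) ((rnorm (a k)) ^+ 2)%:E)%E.

(* the matrix b induces an operator of norm at most |c| on l^2 *)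
Definition matrix_norm_le (b : nat -> nat -> R[i]) (c : R) : Prop :=
  forall a : nat -> R[i], (l2norm2 a < +oo)%E ->
    exists a' : nat -> R[i],
      (forall j, series (fun k => b j k * a k) @ \oo --> a' j) /\
      (l2norm2 a' <= (c ^+ 2)%:E * l2norm2 a)%E.

Definition Linfty_l2 E (alpha : nat -> R -> R[i]) : Prop :=
  (forall j, cmeasurable (alpha j)) /\
  exists c : R, spm_ae E [set x | (l2norm2 (alpha ^~ x) <= c%:E)%E].

Definition Linfty_B E (beta : nat -> nat -> R -> R[i]) : Prop :=
  (forall j k, cmeasurable (beta j k)) /\
  exists c : R, spm_ae E [set x | matrix_norm_le (fun j k => beta j k x) c].

Definition double_psum (f : nat -> nat -> R[i]) (n : nat * nat) : R[i] :=
  \sum_(j < n.1.+1) \sum_(k < n.2.+1) f j k.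

(* As elements of L^infty, the alpha_j, beta_jk, gamma_k are only determined
   up to null sets, so the expansion of Phi is required outside a null set in
   each of the three variables. *)
Definition haagerup_expansion (E1 E2 E3 : spectralMeasure H)
    (alpha : nat -> R -> R[i]) (beta : nat -> nat -> R -> R[i])
    (gamma : nat -> R -> R[i]) (Phi : R -> R -> R -> R[i]) : Prop :=
  [/\ Linfty_l2 E1 alpha, Linfty_B E2 beta, Linfty_l2 E3 gamma &
    exists N1 N2 N3 : set R,
      [/\ spm_null E1 N1, spm_null E2 N2, spm_null E3 N3 &
      forall x1 x2 x3, ~ N1 x1 -> ~ N2 x2 -> ~ N3 x3 ->
        double_psum (fun j k => alpha j x1 * beta j k x2 * gamma k x3)
          @ (\oo, \oo) --> Phi x1 x2 x3]].

Definition haagerup (E1 E2 E3 : spectralMeasure H)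
    (Phi : R -> R -> R -> R[i]) : Prop :=
  exists alpha beta gamma, haagerup_expansion E1 E2 E3 alpha beta gamma Phi.

(* W = \iiint Phi dE1 T dE2 S dE3.  The value does not depend on the expansion
   of Phi, so it may be computed from any of them. *)
Definition is_triple_integral (E1 E2 E3 : spectralMeasure H)
    (Phi : R -> R -> R -> R[i]) (T S W : boundedOp H) : Prop :=
  exists alpha beta gamma, haagerup_expansion E1 E2 E3 alpha beta gamma Phi /\
  exists (A : nat -> boundedOp H) (B : nat -> nat -> boundedOp H)
      (C : nat -> boundedOp H),
    [/\ forall j, is_spectral_integral E1 (alpha j) (A j),
        forall j k, is_spectral_integral E2 (beta j k) (B j k),
        forall k, is_spectral_integral E3 (gamma k) (C k) &
        forall u v : H,
          double_psum (fun j k => dotp H (A j (T (B j k (S (C k u))))) v)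
            @ (\oo, \oo) --> (dotp H (W u) v : R[i])].

End triple_operator_integral.

(* Main.v *)
(* Let (e_j) be the standard basis of l^2 and (f_l) a second orthonormal basis,
   obtained by applying an orthogonal Walsh matrix h to each dyadic block of
   (e_j).  E1 = E3 has atoms e_j and E2 has atoms f_l.  With alpha_j = gamma_j =
   1_{j} and beta_jk = delta_jk sgn(h_j), the triple operator integral of the
   rank one operator Q u = (u, v) w is diagonal in (e_j), with entries
   v_j (B_j w, e_j), where B_j = int sgn(h_jl) dE2(l).  For w = sum_l v_l f_l,
   the unimodular factor sgn(h_j) removes all cancellations from (B_j w, e_j):
   this number is sum_l |h_jl| v_l = 2^(n/2) r^n if j has level n and v_l = r^m
   on the block of the 2^m indices of level m.  Choosing r^2 = 2^(-1/2 - 1/p),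
   the vector v is in l^2 because p < 2, and the diagonal entries are 2^(-n/p),
   each repeated 2^n times, hence not p-summable. *)
Require Import Defs.
From HB Require Import structures.
From mathcomp Require Import all_boot all_order all_algebra.
From mathcomp Require Import sesquilinear.
From mathcomp Require Import all_classical all_reals all_analysis.
From mathcomp Require Import measurable_realfun.
From mathcomp.real_closed Require Import complex.
From mathcomp Require Import ring lra zify.

Set Implicit Arguments.
Unset Strict Implicit.
Unset Printing Implicit Defensive.

Import Order.TTheory GRing.Theory Num.Theory.
Import numFieldNormedType.Exports.

Local Open Scope classical_set_scope.
Local Open Scope ring_scope.

(** * Norms and operators on Hilbert spaces *)

Section rnorm_theory.
Context (R : realType).
Implicit Types (V : normedModType R[i]).

Lemma rnormE V (x : V) : `|x| = (rnorm x)%:C%C.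
Proof. by rewrite RRe_real// ger0_real. Qed.

Lemma rnorm_ge0 V (x : V) : 0 <= rnorm x.
Proof. by rewrite -ler0c -rnormE. Qed.

Lemma rnormD V (x y : V) : rnorm (x + y) <= rnorm x + rnorm y.
Proof. by rewrite -lecR rmorphD/= -!rnormE ler_normD. Qed.

Lemma rnormN V (x : V) : rnorm (- x) = rnorm x.
Proof. by rewrite /rnorm normrN. Qed.

Lemma rnormB V (x y : V) : rnorm (x - y) = rnorm (y - x).
Proof. by rewrite -rnormN opprB. Qed.

Lemma rnormZ V (c : R[i]) (x : V) : rnorm (c *: x) = rnorm c * rnorm x.
Proof. by apply: complexI; rewrite rmorphM/= -!rnormE normrZ. Qed.

Lemma rnormM (x y : R[i]) : rnorm (x * y) = rnorm x * rnorm y.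
Proof. exact: rnormZ. Qed.

Lemma rnorm0 V : rnorm (0 : V) = 0.
Proof. by rewrite /rnorm normr0. Qed.

Lemma rnorm_eq0 V (x : V) : (rnorm x == 0) = (x == 0).
Proof. by rewrite -(inj_eq (@complexI R)) -rnormE normr_eq0. Qed.

Lemma rnorm1 : rnorm (1 : R[i]) = 1.
Proof. by rewrite /rnorm normr1. Qed.

Lemma rnormR (x : R) : rnorm (x%:C%C : R[i]) = `|x|.
Proof. by rewrite /rnorm normc_def/= expr0n addr0 sqrtr_sqr. Qed.

Lemma sqr_rnorm (z : R[i]) :
  rnorm z ^+ 2 = complex.Re z ^+ 2 + complex.Im z ^+ 2.
Proof. by apply: complexI; rewrite rmorphXn/= -rnormE add_Re2_Im2. Qed.

Lemma rnorm_conj (z : R[i]) : rnorm (z^*) = rnorm z.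
Proof. by rewrite /rnorm norm_conjC. Qed.

Lemma mul_conj_rnorm (z : R[i]) : z * z^* = (rnorm z ^+ 2)%:C%C.
Proof. by rewrite -normCK rnormE rmorphXn. Qed.

Lemma rnorm_le_ReIm (z : R[i]) : rnorm z <= `|complex.Re z| + `|complex.Im z|.
Proof.
rewrite -(@ler_pXn2r _ 2%N) ?nnegrE ?rnorm_ge0 ?addr_ge0// sqr_rnorm.
rewrite sqrrD !real_normK ?num_real// -addrA lerD2l lerDr.
by rewrite mulrn_wge0// mulr_ge0.
Qed.

(** The order of [R[i]] compares only elements with equal imaginary parts, so a positive radius is
    real and it suffices to test real radii. *)
Lemma cvg_rnormP V (T : Type) (F : set_system T) (FF : Filter F) (f : T -> V)
    (l : V) :
  f @ F --> l <-> forall e : R, 0 < e -> \forall x \near F, rnorm (l - f x) < e.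
Proof.
split=> [/cvgrPdist_lt fl e e0|fl].
  have /fl : 0 < e%:C%C by rewrite -[0](rmorph0 (real_complex R)) ltcR.
  by apply: filterS => x; rewrite rnormE ltcR.
apply/cvgrPdist_lt => e; rewrite ltcE/= => /andP[/eqP Ime /fl].
apply: filterS => x fx; rewrite rnormE.
by rewrite ltcE/= Ime eqxx.
Qed.

Lemma cvg_complex (T : Type) (F : set_system T) (FF : Filter F) (f : T -> R[i])
    (l : R[i]) :
  complex.Re (f x) @[x --> F] --> complex.Re l ->
  complex.Im (f x) @[x --> F] --> complex.Im l -> f @ F --> l.
Proof.
move=> /cvgrPdist_lt fR /cvgrPdist_lt fI; apply/cvg_rnormP => e e0.
have e20 : 0 < e / 2 by rewrite divr_gt0.
near=> x.
apply: (le_lt_trans (rnorm_le_ReIm _)).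
rewrite [ltRHS](splitr e) !raddfB/=; apply: ltrD.
  by near: x; exact: fR.
by near: x; exact: fI.
Unshelve. all: by end_near. Qed.

Lemma cvg_Re (T : Type) (F : set_system T) (FF : Filter F) (f : T -> R[i])
    (l : R[i]) : f @ F --> l -> complex.Re (f x) @[x --> F] --> complex.Re l.
Proof.
move=> /cvg_rnormP fl; apply/cvgrPdist_lt => e /fl.
apply: filterS => x; apply: le_lt_trans => /=.
by rewrite -raddfB -lecR -rnormE normc_ge_Re.
Qed.

Lemma cvg_rnorm V (T : Type) (F : set_system T) (FF : Filter F) (f : T -> V)
    (l : V) : f @ F --> l -> rnorm (f x) @[x --> F] --> rnorm l.
Proof.
move=> /cvg_rnormP fl; apply/cvgrPdist_lt => e /fl.
apply: filterS => x; apply: le_lt_trans.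
have h1 : rnorm l <= rnorm (l - f x) + rnorm (f x).
  by rewrite -{1}[l](subrK (f x)) rnormD.
have h2 : rnorm (f x) <= rnorm (l - f x) + rnorm l.
  by rewrite rnormB -{1}[f x](subrK l) rnormD.
by rewrite ler_norml; lra.
Qed.

End rnorm_theory.

Section hilbert_theory.
Context (R : realType) (H : hilbertType R).
Implicit Types (u v w : H) (c : R[i]).

Lemma dotDl u v w : dotp H (u + v) w = dotp H u w + dotp H v w.
Proof. exact: linearDl. Qed.

Lemma dotBl u v w : dotp H (u - v) w = dotp H u w - dotp H v w.
Proof. exact: linearBl. Qed.

Lemma dotBr u v w : dotp H u (v - w) = dotp H u v - dotp H u w.
Proof. exact: linearBr. Qed.

Lemma dotZl c u v : dotp H (c *: u) v = c * dotp H u v.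
Proof. exact: linearZl_LR. Qed.

Lemma dotZr c u v : dotp H u (c *: v) = c^* * dotp H u v.
Proof. by rewrite linearZr_LR. Qed.

Lemma dot0l v : dotp H 0 v = 0.
Proof. exact: linear0l. Qed.

Lemma dot_sym u v : dotp H u v = (dotp H v u)^*.
Proof. by rewrite hermC expr0 mul1r. Qed.

Lemma dot_rnorm u : dotp H u u = (rnorm u ^+ 2)%:C%C.
Proof. by rewrite -hnormE rnormE rmorphXn. Qed.

Lemma cauchy_schwarz u v : rnorm (dotp H u v) <= rnorm u * rnorm v.
Proof.
have [->|v0] := eqVneq v 0; first by rewrite linear0r !rnorm0 mulr0.
have nv0 : 0 < rnorm v by rewrite lt_def rnorm_eq0 v0 rnorm_ge0.
(* The vector [a *: v] is the orthogonal projection of [u] on the line of [v]; the squared norm of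
   the remainder is nonnegative, which is the inequality. *)
pose a := dotp H u v / (rnorm v ^+ 2)%:C%C.
have e : (rnorm v ^+ 2)%:C%C != 0 :> R[i].
  by rewrite (inj_eq (@complexI R) _ 0) expf_neq0// gt_eqF.
have : dotp H (u - a *: v) (u - a *: v) =
    (rnorm u ^+ 2 - rnorm (dotp H u v) ^+ 2 / rnorm v ^+ 2)%:C%C.
  rewrite dotBl dotZl !dotBr !dotZr (dot_rnorm v) /a -mulrA.
  rewrite [X in - (dotp H u v * X)]mulrBr (dot_sym v u).
  set d := dotp H u v; set n := (rnorm v ^+ 2)%:C%C.
  have nE : n^-1 = ((rnorm v ^+ 2)^-1)%:C%C by rewrite fmorphV.
  have nR : (n^-1)^* = n^-1 by rewrite nE -[Num.conj]/(@conjc R) conjc_real.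
  rewrite rmorphM/= nR (dot_rnorm u).
  have -> (x y : R) : (x - y / rnorm v ^+ 2)%:C%C = x%:C%C - y%:C%C * n^-1.
    by rewrite nE rmorphB [in LHS](rmorphM (real_complex R)).
  rewrite -mul_conj_rnorm divfK// subrr mulr0 subr0.
  by congr (_ - _); rewrite mulrAC [d * _]mulrC.
rewrite dot_rnorm => /complexI hh.
have := sqr_ge0 (rnorm (u - a *: v)); rewrite hh subr_ge0.
rewrite ler_pdivrMr ?exprn_gt0// -exprMn.
by rewrite ler_pXn2r ?nnegrE// ?mulr_ge0 ?rnorm_ge0.
Qed.

Lemma cvg_dotl (T : Type) (F : set_system T) (FF : Filter F) (f : T -> H) u v :
  f @ F --> u -> dotp H (f x) v @[x --> F] --> dotp H u v.
Proof.
move=> /cvg_rnormP fu; apply/cvg_rnormP => e e0.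
have d0 : 0 < rnorm v + 1 by rewrite ltr_wpDl ?rnorm_ge0.
have /fu : 0 < e / (rnorm v + 1) by rewrite divr_gt0.
apply: filterS => x; rewrite ltr_pdivlMr// -dotBl => h.
apply: le_lt_trans h; apply: le_trans (cauchy_schwarz _ _) _.
by rewrite ler_wpM2l ?rnorm_ge0// lerDl.
Qed.

Section boundedOp_algebra.
Implicit Types S T : boundedOp H.

Lemma subop_bounded S T :
  exists c : R, forall u, rnorm ((S \- T) u) <= c * rnorm u.
Proof.
have [[a ha] [b hb]] := (opfunP S, opfunP T).
exists (a + b) => u /=; apply: le_trans (rnormD _ _) _.
by rewrite rnormN mulrDl lerD.
Qed.

Definition subop S T : boundedOp H := BoundedOp (subop_bounded S T).

Lemma compop_bounded S T :
  exists c : R, forall u, rnorm ((S \o T) u) <= c * rnorm u.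
Proof.
have [[a ha] [b hb]] := (opfunP S, opfunP T).
exists (`|a| * b) => u /=; apply: le_trans (ha _) _.
apply: (le_trans (ler_wpM2r (rnorm_ge0 _) (ler_norm a))).
by rewrite -mulrA ler_wpM2l.
Qed.

Definition compop S T : boundedOp H := BoundedOp (compop_bounded S T).

Lemma zeroop_bounded :
  exists c : R, forall u, rnorm ((\0 : H -> H) u) <= c * rnorm u.
Proof. by exists 0 => u /=; rewrite rnorm0 mul0r. Qed.

Definition zeroop : boundedOp H := BoundedOp zeroop_bounded.

Definition rank1 w v u : H := dotp H u v *: w.

Lemma rank1_linear w v : linear (rank1 w v).
Proof.
by move=> c x y; rewrite /rank1 dotDl dotZl scalerDl scalerA.
Qed.

HB.instance Definition _ w v := GRing.isLinear.Build R[i] H H _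
  (rank1 w v) (rank1_linear w v).

Lemma rank1_bounded w v :
  exists c : R, forall u, rnorm (rank1 w v u) <= c * rnorm u.
Proof.
exists (rnorm v * rnorm w) => u; rewrite rnormZ mulrAC mulrC (mulrC (rnorm w)).
by rewrite ler_wpM2r ?rnorm_ge0// (mulrC (rnorm v)) cauchy_schwarz.
Qed.

Definition rank1op w v : boundedOp H := BoundedOp (rank1_bounded w v).

Lemma cvg_op S (F : set_system nat) (FF : Filter F) (f : nat -> H) u :
  f @ F --> u -> S (f x) @[x --> F] --> S u.
Proof.
have [a ha] := opfunP S.
move=> /cvg_rnormP fu; apply/cvg_rnormP => e e0.
have d0 : 0 < `|a| + 1 by rewrite ltr_wpDl.
have /fu : 0 < e / (`|a| + 1) by rewrite divr_gt0.
apply: filterS => x; rewrite ltr_pdivlMr// -raddfB => h.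
apply: le_lt_trans h; apply: le_trans (ha _) _.
by rewrite mulrC ler_wpM2l ?rnorm_ge0// ler_wpDr// ler_norm.
Qed.

End boundedOp_algebra.
End hilbert_theory.

(** * Integrals of indicator functions *)

Section indicator_integral.
Context (R : realType) (H : hilbertType R) (E : spectralMeasure H).

(** Sigma-additivity on the sequence of empty sets makes a series with constant term [E set0 u]
    converge, so this term is 0. *)
Lemma spm_set0 u : E set0 u = 0.
Proof.
have tF : trivIset [set: nat] (fun=> set0 : set R).
  by apply/trivIsetP => *; rewrite setI0.
have := @spm_sigma_additive _ _ E _ (fun _ => measurable0) tF u.
rewrite bigcup0// => /cvgP/cvg_series_cvg_0 h.
exact: (cvg_unique _ (cvg_cst _) h).
Qed.

Lemma spm_dot A u : measurable A ->
  dotp H (E A u) u = (rnorm (E A u) ^+ 2)%:C%C.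
Proof.
by move=> mA; rewrite -{1}(spm_idem E mA) spm_selfadjoint// dot_rnorm.
Qed.

Lemma scalar_measure0 u : scalar_measure E u set0 = 0%E.
Proof. by rewrite /scalar_measure spm_set0 rnorm0 expr0n. Qed.

Lemma scalar_measure_ge0 u A : (0 <= scalar_measure E u A)%E.
Proof. by rewrite lee_fin sqr_ge0. Qed.

(** Strong convergence of the series of projections passes to the quadratic form, which is the
    squared norm of [E A u] because [E A] is a self-adjoint idempotent. *)
Lemma scalar_measure_sigma_additive u :
  semi_sigma_additive (scalar_measure E u).
Proof.
move=> F mF tF mUF; rewrite /scalar_measure.
have h : complex.Re (dotp H (series (fun n => E (F n) u) n) u) @[n --> \oo] -->
    complex.Re (dotp H (E (\bigcup_n F n) u) u).
  by apply: cvg_Re; apply: cvg_dotl; exact: spm_sigma_additive.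
rewrite (_ : (fun n => _) = EFin \o
    (fun n => complex.Re (dotp H (series (fun n => E (F n) u) n) u))).
  by rewrite spm_dot// in h; apply: cvg_comp h _; exact: cvg_id.
apply/funext => n /=; rewrite sumEFin; congr EFin.
rewrite /series/= -(@applyrE _ _ _ _ _ _ (dotp H)) raddf_sum/= raddf_sum/=.
by apply: eq_bigr => i _; rewrite spm_dot.
Qed.

HB.instance Definition _ u := isMeasure.Build _ _ _ (scalar_measure E u)
  (scalar_measure0 u) (@scalar_measure_ge0 u)
  (@scalar_measure_sigma_additive u).

(** All symbols of the counterexample have this form: an indicator when [T] is empty, a sign
    function when [S] and [T] collect the positive and negative signs. The spectral integral is then
    a difference of two projections. *)
Definition indic_diff (S T : set R) (x : R) : R[i] := (\1_S x - \1_T x)%:C%C.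

Lemma is_spectral_integral_indic_diff (S T : set R) :
  measurable S -> measurable T ->
  is_spectral_integral E (indic_diff S T) (subop (E S) (E T)).
Proof.
move=> mS mT u; rewrite /indic_diff /= dotBl.
rewrite !spm_dot// -rmorphB/= integral0; split=> //.
have i A : measurable A -> (scalar_measure E u).-integrable setT (EFin \o \1_A).
  move=> mA; apply/integrableP; split.
    exact/measurable_EFinP/measurable_indic.
  rewrite (eq_integral (EFin \o \1_A)) => [|x _].
    by rewrite integral_indic// setIT ltry.
  by rewrite gee0_abs// lee_fin.
rewrite (integralB_EFin measurableT (i _ mS) (i _ mT)).
by rewrite !integral_indic// !setIT.
Qed.

End indicator_integral.

(** * The space of square summable sequences *)

Section square_summable.
Context (R : realType).
Implicit Types (a b : nat -> R[i]) (x y z : R[i]).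

Definition psum2 a (n : nat) : R := \sum_(k < n) rnorm (a k) ^+ 2.

Definition square_summable a := exists M : R, forall n, psum2 a n <= M.

Lemma psum2_ge0 a n : 0 <= psum2 a n.
Proof. by apply: sumr_ge0 => k _; rewrite sqr_ge0. Qed.

Lemma psum2_nd a : nondecreasing_seq (psum2 a).
Proof.
apply/nondecreasing_seqP => n; rewrite /psum2 big_ord_recr/= lerDl.
by rewrite sqr_ge0.
Qed.

Lemma psum2Z (c : R[i]) a n : psum2 (c *: a) n = rnorm c ^+ 2 * psum2 a n.
Proof.
by rewrite /psum2 mulr_sumr; apply: eq_bigr => k _; rewrite -exprMn -rnormM.
Qed.

(** A weighted triangle inequality, obtained by completing a square. For fixed [t] it can be summed
    over coordinates, so [t] can be optimized after the summation. *)
Lemma rnormD_sqr (t : R) x y : 0 < t ->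
  rnorm (x + y) ^+ 2 <= (1 + t) * rnorm x ^+ 2 + (1 + t^-1) * rnorm y ^+ 2.
Proof.
move=> t0; apply: (@le_trans _ _ ((rnorm x + rnorm y) ^+ 2)).
  by rewrite ler_pXn2r ?nnegrE ?addr_ge0 ?rnorm_ge0// rnormD.
rewrite -subr_ge0.
set X := rnorm x; set Y := rnorm y.
have -> : (1 + t) * X ^+ 2 + (1 + t^-1) * Y ^+ 2 - (X + Y) ^+ 2 =
  t * (X - t^-1 * Y) ^+ 2 by field; rewrite gt_eqF.
by rewrite mulr_ge0 ?sqr_ge0// ltW.
Qed.

Lemma psum2D (t : R) a b n : 0 < t ->
  psum2 (a + b) n <= (1 + t) * psum2 a n + (1 + t^-1) * psum2 b n.
Proof.
move=> t0; rewrite /psum2 !mulr_sumr -big_split/=.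
by apply: ler_sum => k _; exact: rnormD_sqr.
Qed.

Definition ell2_pred : {pred nat -> R[i]} := mem [set a | square_summable a].

Lemma ell2_submod_closed : submod_closed ell2_pred.
Proof.
split=> [|c a b].
  rewrite inE/=; exists 0 => n; rewrite /psum2 big1// => k _.
  by rewrite rnorm0 expr0n.
rewrite !inE/= => -[M aM] [N bN]; exists (2 * (rnorm c ^+ 2 * M) + 2 * N) => n.
apply: (le_trans (psum2D _ _ _ (@ltr01 R))).
rewrite invr1 -(natrD R 1 1) psum2Z.
by rewrite lerD// ler_wpM2l// ler_wpM2l ?sqr_ge0.
Qed.

HB.instance Definition _ := GRing.isSubmodClosed.Build _ _ ell2_pred
  ell2_submod_closed.

Record ell2 := Ell2 { ell2_seq :> nat -> R[i]; _ : ell2_seq \in ell2_pred }.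

HB.instance Definition _ := [isSub for ell2_seq].
HB.instance Definition _ := [Choice of ell2 by <:].
HB.instance Definition _ := [SubChoice_isSubLmodule of ell2 by <:].

End square_summable.

Section ell2_norm.
Context (R : realType).
Implicit Types (u v w : ell2 R) (c : R[i]).

Lemma ell2P u v : (forall k, u k = v k) -> u = v.
Proof. by move=> uv; apply/val_inj/funext. Qed.

Lemma ell2B u v k : (u - v) k = u k - v k. Proof. by []. Qed.
Lemma ell2Z c u k : (c *: u) k = c * u k. Proof. by []. Qed.

Definition l2norm u : R := Num.sqrt (sup (range (psum2 u))).

Lemma has_sup_psum2 u : has_sup (range (psum2 u)).
Proof.
split; first by exists (psum2 u 0), 0.
case: u => a /=; rewrite inE => -[M aM]; exists M => _ [n _ <-].
exact: aM.
Qed.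

Lemma l2norm_ge0 u : 0 <= l2norm u. Proof. exact: sqrtr_ge0. Qed.

Lemma sqr_l2norm u : l2norm u ^+ 2 = sup (range (psum2 u)).
Proof.
rewrite sqr_sqrtr// (le_trans (psum2_ge0 u 0))//.
by apply: ub_le_sup; [exact: (has_sup_psum2 u).2|exists 0].
Qed.

Lemma psum2_le u n : psum2 u n <= l2norm u ^+ 2.
Proof.
by rewrite sqr_l2norm; apply: ub_le_sup; [exact: (has_sup_psum2 u).2|exists n].
Qed.

Lemma l2norm_le u (M : R) : (forall n, psum2 u n <= M) -> l2norm u ^+ 2 <= M.
Proof.
move=> uM; rewrite sqr_l2norm; apply: ge_sup; first exact: (has_sup_psum2 u).1.
by move=> _ [n _ <-].
Qed.

Lemma psum2_cvg u : psum2 u @ \oo --> l2norm u ^+ 2.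
Proof.
rewrite sqr_l2norm; apply: nondecreasing_cvgn; first exact: psum2_nd.
exact: (has_sup_psum2 u).2.
Qed.

Lemma coord_le u k : rnorm (u k) <= l2norm u.
Proof.
rewrite -(@ler_pXn2r _ 2%N) ?nnegrE ?rnorm_ge0 ?l2norm_ge0//.
apply: le_trans (psum2_le u k.+1); rewrite /psum2 big_ord_recr/= lerDr.
exact: psum2_ge0.
Qed.

Lemma l2norm_eq0 u : l2norm u = 0 -> u = 0.
Proof.
move=> u0; apply: ell2P => k; apply/eqP; rewrite -rnorm_eq0 eq_le rnorm_ge0.
by rewrite -u0 coord_le.
Qed.

Lemma l2normZ c u : l2norm (c *: u) = rnorm c * l2norm u.
Proof.
apply/eqP; rewrite -(@eqrXn2 _ 2%N)// ?mulr_ge0 ?l2norm_ge0 ?rnorm_ge0//.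
have cu : psum2 (c *: u) @ \oo --> rnorm c ^+ 2 * l2norm u ^+ 2.
  rewrite (_ : psum2 _ = fun n => rnorm c ^+ 2 * psum2 u n).
    by apply: cvgMr; exact: psum2_cvg.
  by apply/funext => n; rewrite -psum2Z.
by rewrite exprMn; apply/eqP; apply: (cvg_unique _ (@psum2_cvg (c *: u)) cu).
Qed.

Lemma l2normD u v : l2norm (u + v) <= l2norm u + l2norm v.
Proof.
have [/l2norm_eq0 ->|u0] := eqVneq (l2norm u) 0.
  by rewrite add0r lerDr l2norm_ge0.
have [/l2norm_eq0 ->|v0] := eqVneq (l2norm v) 0.
  by rewrite addr0 lerDl l2norm_ge0.
have u1 : 0 < l2norm u by rewrite lt_def u0 l2norm_ge0.
have v1 : 0 < l2norm v by rewrite lt_def v0 l2norm_ge0.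
rewrite -(@ler_pXn2r _ 2%N) ?nnegrE ?addr_ge0 ?l2norm_ge0//.
apply: l2norm_le => n.
(* the weight for which [rnormD_sqr] sums up to [(l2norm u + l2norm v) ^ 2] *)
pose t := l2norm v / l2norm u.
have t0 : 0 < t by rewrite divr_gt0.
apply: (le_trans (psum2D u v n t0)).
have -> : (l2norm u + l2norm v) ^+ 2 =
    (1 + t) * l2norm u ^+ 2 + (1 + t^-1) * l2norm v ^+ 2.
  by rewrite /t; field; rewrite u0.
rewrite lerD// ler_wpM2l ?psum2_le// addr_ge0// ?invr_ge0 ltW//.
Qed.

Let cnorm u : R[i] := (l2norm u)%:C%C.

Let cnormD u v : cnorm (u + v) <= cnorm u + cnorm v.
Proof. by rewrite -rmorphD/= lecR l2normD. Qed.

Let cnormZ c u : cnorm (c *: u) = `|c| * cnorm u.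
Proof. by rewrite /cnorm l2normZ rnormE rmorphM. Qed.

Let cnorm_eq0 u : cnorm u = 0 -> u = 0.
Proof. by move/complexI/l2norm_eq0. Qed.

HB.instance Definition _ := Lmodule_isNormed.Build R[i] (ell2 R)
  cnormD cnormZ cnorm_eq0.

Lemma rnorm_ell2 u : rnorm u = l2norm u.
Proof. by []. Qed.

End ell2_norm.

(** * Completeness of the sequence space *)

Section ell2_complete.
Context (R : realType).
Implicit Types (u v w : ell2 R).

Lemma cvg_psum2 (T : Type) (F : set_system T) (FF : Filter F)
    (f : T -> nat -> R[i]) (a : nat -> R[i]) n :
  (forall k, f x k @[x --> F] --> a k) ->
  psum2 (f x) n @[x --> F] --> psum2 a n.
Proof.
move=> fa; elim: n => [|n IH].
  rewrite /psum2 big_ord0 (_ : (fun _ => _) = cst 0); first exact: cvg_cst.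
  by apply/funext => x; rewrite big_ord0.
rewrite /psum2 big_ord_recr/=.
rewrite (_ : (fun _ => _) = (fun x => psum2 (f x) n + rnorm (f x n) ^+ 2)).
  apply: cvgD; first exact: IH.
  rewrite expr2 (_ : (fun _ => _) = (fun x => rnorm (f x n) * rnorm (f x n))).
    by apply: cvgM; apply: cvg_rnorm; exact: fa.
  by apply/funext => x; rewrite expr2.
by apply/funext => x; rewrite /psum2 big_ord_recr.
Qed.

Lemma ell2_complete (F : set_system (ell2 R)) :
  ProperFilter F -> cauchy F -> cvg F.
Proof.
move=> FF /cauchyP Fc.
have cF (e : R) : 0 < e -> exists x, F [set y | rnorm (x - y) < e].
  move=> e0; have /Fc[x Fx] : 0 < e%:C%C.
    by rewrite -[0](rmorph0 (real_complex R)) ltcR.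
  by exists x; apply: filterS Fx => y; rewrite -ball_normE/= rnormE ltcR.
(* Coordinates are dominated by the norm and [g] will be [Re] or [Im], so the image filter is Cauchy
   in [R], whose completeness gives the limit. *)
have cvg_coord (g : R[i] -> R) : (forall x y, `|g x - g y| <= rnorm (x - y)) ->
    forall k, cvg ((fun u : ell2 R => g (u k)) @ F).
  move=> gl k; apply: cauchy_cvg; apply: cauchy_exP => e e0.
  have [x Fx] := cF _ e0; exists (g (x k)); rewrite -ball_normE.
  rewrite -[_ _]/(F [set y | `|g (x k) - g (y k)| < e]).
  apply: filterS Fx => y /= h; apply: le_lt_trans h; apply: (le_trans (gl _ _)).
  by rewrite rnorm_ell2; apply: (coord_le (x - y)).
have ReC := cvg_coord (@complex.Re R) _.
have ImC := cvg_coord (@complex.Im R) _.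
have {}ReC k : cvg ((fun u : ell2 R => complex.Re (u k)) @ F).
  apply: ReC => x y; rewrite -raddfB -lecR -rnormE; exact: normc_ge_Re.
have {}ImC k : cvg ((fun u : ell2 R => complex.Im (u k)) @ F).
  apply: ImC => x y; rewrite -raddfB -(@ler_pXn2r _ 2%N) ?nnegrE ?rnorm_ge0//.
  by rewrite sqr_rnorm real_normK ?num_real// lerDr sqr_ge0.
pose a k : R[i] := (lim ((fun u : ell2 R => complex.Re (u k)) @ F) +i*
                    lim ((fun u : ell2 R => complex.Im (u k)) @ F))%C.
have Fa k : (fun u : ell2 R => u k) @ F --> a k.
  by apply: cvg_complex; [exact: ReC|exact: ImC].
(* A Fatou argument: a partial sum involves finitely many coordinates, so the bound passes to the
   coordinatewise limit [a], uniformly in [n]. *)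
have key (x : ell2 R) (e : R) : 0 < e -> F [set y | rnorm (x - y) < e] ->
    forall n, psum2 ((x : nat -> R[i]) - a) n <= e ^+ 2.
  move=> e0 Fx n.
  have h : (fun y : ell2 R => psum2 (x - y) n) @ F -->
      psum2 ((x : nat -> R[i]) - a) n.
    apply: cvg_psum2 => k; apply: cvgB; first exact: cvg_cst.
    exact: Fa.
  apply: (cvgr_to_le h); apply: filterS Fx => y /=.
  rewrite rnorm_ell2 => xy; apply: (le_trans (psum2_le (x - y) n)).
  by rewrite ler_pXn2r ?nnegrE ?l2norm_ge0// ltW.
(* The limit differs from an element of the space by a square summable sequence. *)
have aP : a \in @ell2_pred R.
  have [x Fx] := cF 1 ltr01.
  have xa : (x : nat -> R[i]) - a \in @ell2_pred R.
    by rewrite inE; exists 1 => n; rewrite -(expr1n _ 2); exact: key.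
  rewrite -(subKr (x : nat -> R[i]) a) rpredB//; exact: valP.
apply/cvg_ex; exists (Ell2 aP).
apply/cvg_rnormP => e e0.
have e2 : 0 < e / 2 by rewrite divr_gt0.
have [x Fx] := cF _ e2; near=> y.
have xa : rnorm (x - Ell2 aP) <= e / 2.
  rewrite rnorm_ell2 -(@ler_pXn2r _ 2%N) ?nnegrE ?l2norm_ge0 ?(ltW e2)//.
  by apply: l2norm_le => n; apply: key.
have -> : Ell2 aP - y = (x - y) - (x - Ell2 aP).
  by rewrite opprB [RHS]addrC addrA subrK.
apply: (le_lt_trans (rnormD _ _)); rewrite rnormN [ltRHS]splitr ltr_leD//.
by near: y.
Unshelve. all: by end_near. Qed.

HB.instance Definition _ := Uniform_isComplete.Build (ell2 R) ell2_complete.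

End ell2_complete.

(** * The inner product, by polarization *)

Section ell2_dot.
Context (R : realType).
Implicit Types (u v w : ell2 R).

Definition dsum (a b : nat -> R[i]) n : R[i] := \sum_(k < n) a k * (b k)^*.

Lemma dsum_psum2 (a : nat -> R[i]) n : dsum a a n = (psum2 a n)%:C%C.
Proof.
rewrite /dsum /psum2 rmorph_sum.
by apply: eq_bigr => k _; rewrite mul_conj_rnorm.
Qed.

Definition l2dot u v : R[i] := lim (dsum u v @ \oo).

Lemma polar_Re (x y : R[i]) : complex.Re (x * y^*) =
  (rnorm (x + y) ^+ 2 - rnorm x ^+ 2 - rnorm y ^+ 2) / 2.
Proof.
rewrite !sqr_rnorm -[Num.conj]/(@conjc R).
by case: x y => [a b] [c d] /=; field.
Qed.

(** Since Im z = Re (- i z) and - i has modulus 1, this is the identity for the real part, applied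
    to - i x. *)
Lemma polar_Im (x y : R[i]) : complex.Im (x * y^*) =
  (rnorm ((- 'i)%C * x + y) ^+ 2 - rnorm x ^+ 2 - rnorm y ^+ 2) / 2.
Proof.
rewrite !sqr_rnorm -[Num.conj]/(@conjc R).
by case: x y => [a b] [c d] /=; field.
Qed.

(** By polarization, the real and imaginary parts of the partial sums are combinations of partial
    sums of squared norms, each of which converges. *)
Lemma l2dot_cvg u v : dsum u v @ \oo --> l2dot u v.
Proof.
have reE n : complex.Re (dsum u v n) =
    (psum2 (u + v) n - psum2 u n - psum2 v n) / 2.
  rewrite /dsum /psum2 raddf_sum/= -!sumrB mulr_suml.
  by apply: eq_bigr => k _; exact: polar_Re.
have imE n : complex.Im (dsum u v n) =
    (psum2 ((- 'i)%C *: u + v) n - psum2 u n - psum2 v n) / 2.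
  rewrite /dsum /psum2 raddf_sum/= -!sumrB mulr_suml.
  by apply: eq_bigr => k _; exact: polar_Im.
have cv (x y z : ell2 R) :
    (psum2 x n - psum2 y n - psum2 z n) / 2 @[n --> \oo] -->
    (l2norm x ^+ 2 - l2norm y ^+ 2 - l2norm z ^+ 2) / 2.
  by apply: cvgMl; apply: cvgB; [apply: cvgB|]; exact: psum2_cvg.
apply/cvg_ex; exists
  ((l2norm (u + v) ^+ 2 - l2norm u ^+ 2 - l2norm v ^+ 2) / 2 +i*
   ((l2norm ((- 'i)%C *: u + v) ^+ 2 - l2norm u ^+ 2 - l2norm v ^+ 2) / 2))%C.
apply: cvg_complex => /=.
  by under eq_fun do rewrite reE; exact: cv.
by under eq_fun do rewrite imE; exact: cv.
Qed.

Lemma l2dot_unique u v l : dsum u v @ \oo --> l -> l2dot u v = l.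
Proof. by move=> h; apply: (cvg_unique _ (@l2dot_cvg u v) h). Qed.

Lemma l2dot_herm u v : l2dot u v = (-1) ^+ false * (l2dot v u)^*.
Proof.
rewrite expr0 mul1r; apply: l2dot_unique; apply/cvg_rnormP => e e0.
have /cvg_rnormP/(_ e e0) := @l2dot_cvg v u; apply: filterS => n.
rewrite -rnorm_conj rmorphB/= /dsum rmorph_sum/=.
congr (rnorm (_ - _) < e); apply: eq_bigr => k _.
by rewrite rmorphM/= conjCK mulrC.
Qed.

Lemma l2dot_linearl w : linear_for *%R (l2dot ^~ w).
Proof.
move=> c u v; apply: l2dot_unique.
rewrite (_ : dsum _ _ = (fun n => c * dsum u w n + dsum v w n)).
  by apply: cvgD; [apply: cvgMr|]; exact: l2dot_cvg.
apply/funext => n; rewrite /dsum mulr_sumr -big_split/=.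
by apply: eq_bigr => k _; rewrite mulrDl mulrA.
Qed.

Lemma l2dot_bilinear : bilinear_for *%R (Num.conj \; *%R) (@l2dot).
Proof.
split=> [v|u]; first exact: l2dot_linearl.
move=> c v w; rewrite l2dot_herm expr0 mul1r l2dot_linearl rmorphD rmorphM/=.
by rewrite [l2dot u v]l2dot_herm [l2dot u w]l2dot_herm !expr0 !mul1r.
Qed.

Lemma l2dot_norm u : `|u| ^+ 2 = l2dot u u.
Proof.
apply/esym/l2dot_unique; rewrite rnormE -rmorphXn/=.
apply: cvg_complex => /=; under eq_fun do rewrite dsum_psum2.
  exact: psum2_cvg.
exact: cvg_cst.
Qed.

Lemma l2dot_gt0 u : u != 0 -> 0 < l2dot u u.
Proof. by move=> u0; rewrite -l2dot_norm exprn_gt0// normr_gt0. Qed.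

HB.instance Definition _ := @bilinear_isBilinear.Build R[i] (ell2 R) (ell2 R)
  R[i] *%R (Num.conj \; *%R) (@l2dot) l2dot_bilinear.
HB.instance Definition _ := @isHermitianSesquilinear.Build R[i] (ell2 R)
  false Num.conj (@l2dot) l2dot_herm.
HB.instance Definition _ :=
  @isDotProduct.Build R[i] (ell2 R) (@l2dot) l2dot_gt0.

Definition ell2H : hilbertType R :=
  @HilbertType R (ell2 R) (@l2dot) l2dot_norm.

End ell2_dot.

(** * Purely atomic spectral measures *)

Section diagonal_operator.
Context (R : realType).
Implicit Types (u v : ell2 R) (b : nat -> R[i]).

Lemma psum2_diag b u n : (forall k, rnorm (b k) <= 1) ->
  psum2 (b \* u) n <= l2norm u ^+ 2.
Proof.
move=> b1; apply: le_trans (psum2_le u n); apply: ler_sum => k _ /=.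
rewrite rnormM exprMn ler_piMl ?sqr_ge0// -(expr1n _ 2).
by rewrite ler_pXn2r ?nnegrE ?rnorm_ge0.
Qed.

Lemma square_summable_diag b u : (forall k, rnorm (b k) <= 1) ->
  b \* u \in @ell2_pred R.
Proof.
by move=> b1; rewrite inE; exists (l2norm u ^+ 2) => n; exact: psum2_diag.
Qed.

Definition diag b (b1 : forall k, rnorm (b k) <= 1) u : ell2H R :=
  Ell2 (square_summable_diag u b1).

Context (b : nat -> R[i]) (b1 : forall k, rnorm (b k) <= 1).

Lemma diag_linear : linear (diag b1 : ell2H R -> ell2H R).
Proof. by move=> c u v; apply: ell2P => k /=; rewrite mulrDr mulrCA. Qed.

HB.instance Definition _ := GRing.isLinear.Build R[i] (ell2H R) (ell2H R) _
  (diag b1) diag_linear.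

Lemma diag_le1 u : l2norm (diag b1 u) <= l2norm u.
Proof.
rewrite -(@ler_pXn2r _ 2%N) ?nnegrE ?l2norm_ge0//.
by apply: l2norm_le => n; exact: psum2_diag.
Qed.

Lemma diag_bounded :
  exists c : R, forall u : ell2H R, rnorm (diag b1 u) <= c * rnorm u.
Proof. by exists 1 => u; rewrite mul1r; exact: diag_le1. Qed.

Definition diagop : boundedOp (ell2H R) := BoundedOp diag_bounded.

Lemma diagE u k : (diagop u : ell2 R) k = b k * u k.
Proof. by []. Qed.

Lemma diag_selfadjoint : (forall k, (b k)^* = b k) -> forall u v,
  dotp (ell2H R) (diagop u) v = dotp (ell2H R) u (diagop v).
Proof.
move=> bR u v; apply: l2dot_unique; rewrite (_ : dsum _ _ = dsum u (diagop v)).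
  exact: l2dot_cvg.
apply/funext => n; apply: eq_bigr => k _ /=.
by rewrite rmorphM/= bR mulrCA mulrA.
Qed.

End diagonal_operator.

Section atomic_spectral_measure.
Context (R : realType).
Let H := ell2H R.

(** The spectral measures live on the natural numbers inside [R]: a set acts on the coordinate [k]
    only through whether it contains [k%:R]. *)
Definition atoms (A : set R) (k : nat) : R[i] := \1_A (k%:R : R).

Lemma atoms_le1 A k : rnorm (atoms A k) <= 1.
Proof.
by rewrite /atoms indicE; case: (_ \in _); rewrite ?rnorm1 ?rnorm0.
Qed.

Definition coordproj (A : set R) : boundedOp H := diagop (atoms_le1 A).

Lemma ell2_sum (f : nat -> H) n k :
  (\sum_(i < n) f i : ell2 R) k = \sum_(i < n) (f i : ell2 R) k.
Proof.
elim: n => [|n IH]; first by rewrite !big_ord0.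
by rewrite !big_ord_recr/= -IH.
Qed.

(** By disjointness, [k%:R] lies in at most one [F i0], so the remainder drops from 1 to 0 once [n]
    exceeds [i0]. The two parts are the domination and the pointwise convergence for a dominated
    convergence argument. *)
Lemma atoms_bigcup (F : (set R)^nat) k : trivIset setT F ->
  (forall n,
    rnorm (atoms (\bigcup_i F i) k - \sum_(i < n) atoms (F i) k) <= 1) /\
  \forall n \near \oo, atoms (\bigcup_i F i) k - \sum_(i < n) atoms (F i) k = 0.
Proof.
move=> tF; have [[i0 _ Fi0]|nF] := pselect ((\bigcup_i F i) (k%:R : R)).
  have Fi i : atoms (F i) k = (i == i0)%:R.
    rewrite /atoms indicE; congr (nat_of_bool _)%:R.
    apply/idP/eqP => [|->]; last by rewrite inE.
    by rewrite inE => Fi; apply: tF => //; exists k%:R.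
  have UF : atoms (\bigcup_i F i) k = 1.
    by rewrite /atoms indicE mem_set//; exists i0.
  have E n :
      atoms (\bigcup_i F i) k - \sum_(i < n) atoms (F i) k = (n <= i0)%:R.
    rewrite UF; have [ni|ni] := leqP n i0.
      rewrite big1 ?subr0// => i _.
      by rewrite Fi ltn_eqF// (leq_trans (ltn_ord i)).
    rewrite (bigD1 (Ordinal ni))//= Fi eqxx big1 ?addr0 ?subrr// => i ii0.
    by rewrite Fi -(inj_eq val_inj)/= in ii0 *; rewrite (negbTE ii0).
  split=> [n|]; first by rewrite E; case: (_ <= _)%N; rewrite ?rnorm1 ?rnorm0.
  by exists i0.+1 => // n /= ni; rewrite E leqNgt ni.
have UF : atoms (\bigcup_i F i) k = 0.
  by rewrite /atoms indicE memNset.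
have Fi i : atoms (F i) k = 0.
  by rewrite /atoms indicE memNset// => Fik; apply: nF; exists i.
have E n : atoms (\bigcup_i F i) k - \sum_(i < n) atoms (F i) k = 0.
  by rewrite UF big1 ?subr0.
by split=> [n|]; [rewrite E rnorm0|exists 0%N => // n _; rewrite E].
Qed.

(** Beyond a large [K], the remainder is dominated by the small tail of [u]; the finitely many
    coordinates below [K] vanish for large [n]. *)
Lemma coordproj_sigma_additive (F : (set R)^nat) (u : H) : trivIset setT F ->
  series (fun n => coordproj (F n) u) @ \oo --> coordproj (\bigcup_n F n) u.
Proof.
move=> tF; apply/cvg_rnormP => e e0.
pose z n : H :=
  coordproj (\bigcup_n F n) u - series (fun n => coordproj (F n) u) n.
have zE n k : (z n : ell2 R) k =
    (atoms (\bigcup_i F i) k - \sum_(i < n) atoms (F i) k) * (u : ell2 R) k.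
  rewrite /z ell2B /series/= big_mkord mulrBl mulr_suml; congr (_ - _).
  exact: (ell2_sum (fun n => coordproj (F n) u)).
have [K _ uK] : \forall K \near \oo, l2norm u ^+ 2 - psum2 u K < e ^+ 2.
  have e20 : 0 < e ^+ 2 by rewrite exprn_gt0.
  have /cvgrPdist_lt/(_ _ e20) := @psum2_cvg _ u.
  apply: filterS => n; apply: le_lt_trans; exact: ler_norm.
have [N _ hN] : \forall n \near \oo,
    forall k, (k < K)%N -> (z n : ell2 R) k = 0.
  have h (k : 'I_K) : \forall n \near \oo, (z n : ell2 R) k = 0.
    have [_] := atoms_bigcup k tF; apply: filterS => n hn.
    by rewrite zE hn mul0r.
  have : \forall n \near \oo, forall k : 'I_K, (z n : ell2 R) k = 0.
    exact: filter_forall.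
  by apply: filterS => n hn k kK; exact: (hn (Ordinal kK)).
exists N => // n /hN; rewrite -/(z n) rnorm_ell2.
move: (z n) (zE n) => y yE zn0.
rewrite -(@ltr_pXn2r _ 2%N) ?nnegrE ?l2norm_ge0 ?(ltW e0)//.
apply: le_lt_trans (uK K (leqnn _)).
apply: l2norm_le => m; rewrite lerBrDr.
(* As [y] vanishes below [K] and is dominated by [u] above, its sum and the head of [u] occupy
   disjoint ranges of indices and together stay below a partial sum of [u]. *)
apply: (@le_trans _ _ (psum2 u (maxn m K))); last exact: psum2_le.
apply: (@le_trans _ _ (psum2 (y : ell2 R) (maxn m K) + psum2 u K)).
  by rewrite lerD2r; apply: psum2_nd; exact: leq_maxl.
rewrite /psum2 -!(big_mkord xpredT (fun k => rnorm (_ k) ^+ 2)).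
rewrite (@big_cat_nat _ _ _ K 0 (maxn m K))//= ?leq_maxr// big1_seq ?add0r.
  rewrite [leRHS](@big_cat_nat _ _ _ K)//= ?leq_maxr// [leRHS]addrC.
  apply: lerD => //.
  apply: ler_sum => k _; rewrite yE rnormM exprMn ler_piMl ?sqr_ge0//.
  rewrite -(expr1n _ 2) ler_pXn2r ?nnegrE ?rnorm_ge0//.
  exact: (atoms_bigcup k tF).1.
move=> k /andP[_]; rewrite mem_index_iota => /andP[_ kK].
by rewrite zn0 ?rnorm0 ?expr0n.
Qed.

Context (V : boundedOp H) (VK : forall u, V (V u) = u).
Context (Vsym : forall u v, dotp H (V u) v = dotp H u (V v)).

(** The operator [V] is a self-adjoint involution, hence unitary and equal to its inverse: this is
    the coordinate projection transported to the orthonormal basis of the vectors [V] e_k. *)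
Definition atomic (A : set R) : boundedOp H :=
  compop V (compop (coordproj A) V).

Lemma atomic_idem A u : atomic A (atomic A u) = atomic A u.
Proof.
rewrite /= VK; congr (V _); apply: ell2P => k /=.
by rewrite mulrA /atoms -natrM indicE; case: (_ \in _).
Qed.

Lemma atomic_selfadjoint A u v : dotp H (atomic A u) v = dotp H u (atomic A v).
Proof.
rewrite /= Vsym; have := @diag_selfadjoint R _ (atoms_le1 A) _ (V u) (V v).
rewrite Vsym; apply => k; rewrite /atoms; exact: rmorph_nat.
Qed.

Lemma atomic_setT u : atomic setT u = u.
Proof.
rewrite /= (_ : diag _ _ = V u) ?VK//; apply: ell2P => k /=.
by rewrite /atoms indicT mul1r.
Qed.

Lemma atomic_sigma_additive (F : (set R)^nat) : trivIset setT F ->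
  forall u, series (fun n => atomic (F n) u) @ \oo --> atomic (\bigcup_n F n) u.
Proof.
move=> tF u; rewrite (_ : series _ =
    fun n => V (series (fun n => coordproj (F n) (V u)) n)).
  by apply: cvg_op; exact: coordproj_sigma_additive.
by apply/funext => n; rewrite /series/= raddf_sum.
Qed.

Definition atomic_measure : spectralMeasure H := SpectralMeasure
  (fun A _ => atomic_idem A) (fun A _ => atomic_selfadjoint A)
  atomic_setT (fun F _ => @atomic_sigma_additive F).

End atomic_spectral_measure.

(** * Walsh matrices *)

Section walsh.
Context (R : realType).

Let s : R := (Num.sqrt 2)^-1.

Let s2 : s * s = 2^-1.
Proof. by rewrite -invfM -expr2 sqr_sqrtr. Qed.

Let s0 : 0 < s. Proof. by rewrite invr_gt0 sqrtr_gt0. Qed.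

Definition level (a : nat) : nat := trunc_log 2 a.

Lemma level1 : level 1 = 0%N. Proof. exact: trunc_log1. Qed.

Lemma levelS (i : bool) a : (0 < a)%N -> level (i + a.*2) = (level a).+1.
Proof.
move=> a0; rewrite /level trunc_log2S ?half_bit_double//.
by case: i; lia.
Qed.

Lemma level_lt a n : (0 < a)%N -> (level a < n)%N = (a < 2 ^ n)%N.
Proof.
move=> a0; apply/idP/idP => [an|].
  by apply: (leq_trans (@trunc_log_ltn 2 a isT)); rewrite leq_exp2l.
apply: contraTT; rewrite -!leqNgt => /(leq_pexp2l (isT : 0 < 2)%N) h.
exact: leq_trans h (@trunc_logP 2 a isT a0).
Qed.

(* Rows and columns start at 1.  Up to the factor s ^ n, the entry at two
   indices of level n (with n + 1 binary digits) is (-1) ^ <a, b>, where <a, b>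
   is the inner product of the digit vectors without their leading 1. *)
Definition walsh (a b : nat) : R := if level a == level b then
  \prod_(i < level a) (s * (-1) ^+ (odd (a %/ 2 ^ i) && odd (b %/ 2 ^ i)))
  else 0.

Lemma walshC a b : walsh a b = walsh b a.
Proof.
rewrite /walsh eq_sym; case: eqP => // ->.
by apply: eq_bigr => i _; rewrite andbC.
Qed.

Lemma walsh11 : walsh 1 1 = 1.
Proof. by rewrite /walsh eqxx level1 big_ord0. Qed.

Lemma walsh1S (j : bool) b : (0 < b)%N -> walsh 1 (j + b.*2) = 0.
Proof. by move=> b0; rewrite /walsh level1 levelS. Qed.

(** The last binary digits split off from the product as one 2 x 2 Hadamard factor. This tensor
    recursion drives the two row sums below. *)
Lemma walshSS (i j : bool) a b : (0 < a)%N -> (0 < b)%N ->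
  walsh (i + a.*2) (j + b.*2) = s * (-1) ^+ (i && j) * walsh a b.
Proof.
move=> a0 b0; rewrite /walsh !levelS// eqSS.
case: eqP => _; last by rewrite mulr0.
rewrite big_ord_recl/= expn0 !divn1 !oddD !odd_double !addbF !oddb.
congr (_ * _); apply: eq_bigr => k _.
have e (l : bool) c : ((l + c.*2) %/ 2 ^ bump 0 k = c %/ 2 ^ k)%N.
  by rewrite /bump/= add1n expnS divnMA divn2 half_bit_double.
by rewrite !e.
Qed.

Lemma walsh_supp n a b : (0 < a < 2 ^ n)%N -> (2 ^ n <= b)%N -> walsh a b = 0.
Proof.
move=> /andP[a0 an] nb; rewrite /walsh; case: eqP => // ab.
have b0 : (0 < b)%N by apply: leq_trans nb; rewrite expn_gt0.
by move: an; rewrite -level_lt// ab level_lt// ltnNge nb.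
Qed.

(** Labels above 1 are grouped by their last binary digit, so that [walshSS] applies to each
    term. *)
Lemma sum_nat_double (F : nat -> R) m : (0 < m)%N ->
  \sum_(1 <= l < m.*2) F l =
  F 1%N + \sum_(1 <= b < m) (F (false + b.*2)%N + F (true + b.*2)%N).
Proof.
case: m => // m _; elim: m => [|m IH].
  by rewrite big_nat1 big_geq// addr0.
rewrite doubleS big_nat_recr//= big_nat_recr//= IH [in RHS]big_nat_recr//=.
by rewrite !addrA.
Qed.

Lemma label_ind (P : nat -> Prop) : P 1%N ->
  (forall (i : bool) a, (0 < a)%N -> P a -> P (i + a.*2)%N) ->
  forall a, (0 < a)%N -> P a.
Proof.
move=> P1 PS; elim/ltn_ind => a IH a0.
have [->//|a1] := eqVneq a 1%N.
have h0 : (0 < a./2)%N by rewrite half_gt0; lia.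
rewrite -(odd_double_half a); apply: PS => //; apply: IH => //.
by rewrite ltn_half_double; lia.
Qed.

Lemma walsh_orth n a b : (0 < a < 2 ^ n)%N -> (0 < b < 2 ^ n)%N ->
  \sum_(1 <= l < 2 ^ n) walsh a l * walsh l b = (a == b)%:R.
Proof.
move=> /andP[a0]; move: a a0 b n.
apply: label_ind => [|i a a0 IH] b [|n] an /andP[b0 bn].
- by move: an.
- rewrite expnS mul2n sum_nat_double ?expn_gt0// walsh11 mul1r.
  rewrite big_nat big1 ?addr0; last first.
    by move=> l /andP[l0 _]; rewrite !walsh1S// !mul0r addr0.
  move: b b0 {bn}; apply: label_ind => [|j b b0 _]; first by rewrite walsh11.
  by rewrite walsh1S//; case: eqP => //; case: j; lia.
- by move: an; lia.
rewrite expnS mul2n sum_nat_double ?expn_gt0//.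
move: b b0 bn; apply: label_ind => [_|j b b0 _ bn].
  rewrite walshC walsh1S// mul0r add0r big_nat big1.
    by case: eqP => //; case: (i); lia.
  by move=> l /andP[l0 _]; rewrite ![walsh _ 1]walshC !walsh1S// !mulr0 addr0.
rewrite walshC walsh1S// mul0r add0r.
have -> : (i + a.*2 == j + b.*2)%N = (i == j) && (a == b).
  by case: (i); case: (j); lia.
(* Summing over the last digit of the middle index is the orthogonality of the 2 x 2 factor: (1 +
   (-1)^(i+j)) / 2 is 1 if [i = j] and 0 otherwise. *)
have E l : (0 < l)%N ->
   walsh (i + a.*2) (false + l.*2) * walsh (false + l.*2) (j + b.*2) +
   walsh (i + a.*2) (true + l.*2) * walsh (true + l.*2) (j + b.*2) =
   (i == j)%:R * (walsh a l * walsh l b).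
  move=> l0; rewrite !walshSS//.
  transitivity (s * s * (1 + (-1) ^+ i * (-1) ^+ j) * (walsh a l * walsh l b)).
    by rewrite !andbF !andFb !andbT !andTb !expr0; ring.
  by rewrite s2; case: (i); case: (j) => /=; rewrite ?expr0 ?expr1; field.
rewrite (eq_big_nat _ _ (fun l hl => E l (andP hl).1)) -mulr_sumr IH.
- by rewrite -natrM mulnb.
- by move: an; rewrite expnS mul2n; case: (i); lia.
- by rewrite b0/=; move: bn; rewrite expnS mul2n; case: (j); lia.
Qed.

(** Without signs, each binary digit multiplies the sum by 2 s r = sqrt 2 r: a row of level n has
    2^n entries of modulus 2^(-n/2). *)
Lemma walsh_abs_sum (r : R) n a : (0 < a < 2 ^ n)%N ->
  \sum_(1 <= l < 2 ^ n) `|walsh a l| * r ^+ level l =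
    (Num.sqrt 2 * r) ^+ level a.
Proof.
have ss : s + s = Num.sqrt 2.
  have q2 : Num.sqrt 2 * Num.sqrt 2 = 2 :> R by rewrite -expr2 sqr_sqrtr.
  apply: (@mulfI _ s); first by rewrite gt_eqF.
  by rewrite mulrDr s2 /s mulVf ?gt_eqF ?sqrtr_gt0//; field.
move=> /andP[a0]; move: a a0 n; apply: label_ind => [|i a a0 IH] [|n] an.
- by move: an.
- rewrite expnS mul2n sum_nat_double ?expn_gt0// walsh11 level1 normr1 mul1r.
  rewrite big_nat big1 ?addr0 ?expr0//.
  by move=> l /andP[l0 _]; rewrite !walsh1S// normr0 !mul0r addr0.
- by move: an; lia.
rewrite expnS mul2n sum_nat_double ?expn_gt0//.
rewrite walshC walsh1S// normr0 mul0r add0r levelS//.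
have E l : (0 < l)%N ->
   `|walsh (i + a.*2) (false + l.*2)| * r ^+ level (false + l.*2) +
   `|walsh (i + a.*2) (true + l.*2)| * r ^+ level (true + l.*2) =
   (Num.sqrt 2 * r) * (`|walsh a l| * r ^+ level l).
  move=> l0; rewrite !walshSS// !levelS// !normrM !normr_sign (gtr0_norm s0).
  by rewrite -ss exprS; ring.
rewrite (eq_big_nat _ _ (fun l hl => E l (andP hl).1)) -mulr_sumr IH ?exprS//.
by move: an; rewrite expnS mul2n; case: (i); lia.
Qed.

(** The 2^m labels of level m contribute (2 q)^m. In the induction a further level turns a sum S
    into 1 + 2 q S, of which the bound is the fixed point. *)
Lemma sum_level (q : R) n : 0 <= q -> q * 2 < 1 ->
  \sum_(1 <= l < 2 ^ n) q ^+ level l <= (1 - q * 2)^-1.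
Proof.
move=> q0 q1; have d0 : 0 < 1 - q * 2 by rewrite subr_gt0.
elim: n => [|n IH]; first by rewrite expn0 big_geq// invr_ge0 ltW.
rewrite expnS mul2n sum_nat_double ?expn_gt0// level1 expr0.
rewrite (@eq_big_nat _ _ _ _ _ _ (fun l => (q * 2) * q ^+ level l)); last first.
  by move=> l /andP[l0 _]; rewrite !levelS// exprS; ring.
rewrite -mulr_sumr; apply: (@le_trans _ _ (1 + q * 2 * (1 - q * 2)^-1)).
  by rewrite lerD2l ler_wpM2l// mulr_ge0.
by rewrite le_eqVlt; apply/orP; left; apply/eqP; field; rewrite gt_eqF.
Qed.

End walsh.

(** * Operators of symmetric block orthogonal matrices *)

Section block_orthogonal_operator.
Context (R : realType) (h : nat -> nat -> R) (bd : nat -> nat).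
Hypotheses (hC : forall j l, h j l = h l j) (bd_ge : forall n, (n <= bd n)%N).
Hypothesis hsupp : forall n j l, (j < bd n)%N -> (bd n <= l)%N -> h j l = 0.
Hypothesis horth : forall n j m, (j < bd n)%N -> (m < bd n)%N ->
  \sum_(l < bd n) h j l * h l m = (j == m)%:R.
Implicit Types (a b : nat -> R[i]) (u v : ell2 R).

(** As [j < bd j.+1], the row [j] vanishes from [bd j.+1] on by [hsupp], so this finite sum is the
    full matrix product. *)
Definition mulh a (j : nat) : R[i] := \sum_(l < bd j.+1) (h j l)%:C%C * a l.

(** One cut-off can serve all rows below it, which allows finite sums to be exchanged. *)
Lemma mulhE a n j : (j < bd n)%N ->
  mulh a j = \sum_(l < bd n) (h j l)%:C%C * a l.
Proof.
suff H p q : (bd p <= bd q)%N -> (j < bd p)%N ->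
    \sum_(l < bd q) (h j l)%:C%C * a l = \sum_(l < bd p) (h j l)%:C%C * a l.
  by move=> jn; have [/H ->//|/ltnW/H <-//] := leqP (bd j.+1) (bd n).
move=> pq jp; rewrite -!(big_mkord xpredT (fun l => (h j l)%:C%C * a l)).
rewrite (@big_cat_nat _ _ _ (bd p))//= [X in _ + X]big_nat.
rewrite [X in _ + X]big1 ?addr0//.
by move=> l /andP[pl _]; rewrite (hsupp jp pl) rmorph0 mul0r.
Qed.

Lemma mulhK a j : mulh (mulh a) j = a j.
Proof.
have jn : (j < bd j.+1)%N := bd_ge _.
rewrite (mulhE _ jn).
under eq_bigr => l _ do rewrite (mulhE _ (ltn_ord l)) mulr_sumr.
rewrite exchange_big/= (bigD1 (Ordinal jn))//= [X in _ + X]big1 ?addr0.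
  under eq_bigr => l _ do rewrite mulrA -rmorphM.
  by rewrite -mulr_suml -rmorph_sum/= horth// eqxx mul1r.
move=> m mj; under eq_bigr => l _ do rewrite mulrA -rmorphM.
rewrite -mulr_suml -rmorph_sum/= horth// -[j]/(val (Ordinal jn)) val_eqE eq_sym.
by rewrite (negbTE mj) rmorph0 mul0r.
Qed.

Lemma dsum_mulh a b n : dsum (mulh a) b (bd n) = dsum a (mulh b) (bd n).
Proof.
rewrite /dsum.
under eq_bigr => j _ do rewrite (mulhE _ (ltn_ord j)) mulr_suml.
under [RHS]eq_bigr => j _ do rewrite (mulhE _ (ltn_ord j)) rmorph_sum mulr_sumr.
rewrite exchange_big/=; apply: eq_bigr => l _; apply: eq_bigr => j _.
rewrite rmorphM/= -[Num.conj (h _ _)%:C%C]/(conjc _) conjc_real hC.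
by rewrite mulrAC mulrC mulrA.
Qed.

(** Cut at [bd n], the matrix is symmetric and its own inverse, hence isometric; the partial sum at
    [n] is below the one at [bd n]. *)
Lemma psum2_mulh_le u n : psum2 (mulh u) n <= l2norm u ^+ 2.
Proof.
apply: (@le_trans _ _ (psum2 (mulh u) (bd n))).
  by apply: psum2_nd; exact: bd_ge.
rewrite (_ : psum2 _ _ = psum2 u (bd n)) ?psum2_le//.
apply: complexI; rewrite -!dsum_psum2 dsum_mulh.
by apply: eq_bigr => k _; rewrite mulhK.
Qed.

Lemma square_summable_mulh u : mulh u \in @ell2_pred R.
Proof. by rewrite inE; exists (l2norm u ^+ 2) => n; exact: psum2_mulh_le. Qed.

Definition hmul u : ell2H R := Ell2 (square_summable_mulh u).

Lemma hmul_linear : linear (hmul : ell2H R -> ell2H R).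
Proof.
move=> c u v; apply: ell2P => k /=; rewrite /mulh.
rewrite (_ : (c *: _ + _) k = c * mulh u k + mulh v k)//.
rewrite /mulh mulr_sumr -big_split/=.
by apply: eq_bigr => l _; rewrite mulrDr mulrCA.
Qed.

HB.instance Definition _ := GRing.isLinear.Build R[i] (ell2H R) (ell2H R) _
  hmul hmul_linear.

Lemma hmul_bounded :
  exists c : R, forall u : ell2H R, rnorm (hmul u) <= c * rnorm u.
Proof.
exists 1 => u; rewrite mul1r !rnorm_ell2.
rewrite -(@ler_pXn2r _ 2%N) ?nnegrE ?l2norm_ge0//.
by apply: l2norm_le => n; exact: psum2_mulh_le.
Qed.

Definition hop : boundedOp (ell2H R) := BoundedOp hmul_bounded.

Lemma hopK u : hop (hop u) = u.
Proof. by apply: ell2P => k; exact: mulhK. Qed.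

(** The identity is exact for the partial sums at the cut-offs [bd n], and these tend to
    infinity. *)
Lemma hop_selfadjoint u v :
  dotp (ell2H R) (hop u) v = dotp (ell2H R) u (hop v).
Proof.
have bdoo : bd @ \oo --> \oo.
  move=> A [N _ NA]; exists N => // n /= Nn.
  by apply: NA => /=; exact: leq_trans (bd_ge n).
have h1 : dsum (hop u) v (bd n) @[n --> \oo] --> l2dot (hop u) v.
  by apply: cvg_comp bdoo _; exact: l2dot_cvg.
have h2 : dsum (hop u) v (bd n) @[n --> \oo] --> l2dot u (hop v).
  under eq_fun do rewrite dsum_mulh.
  by apply: cvg_comp bdoo _; exact: (@l2dot_cvg _ u (hop v)).
exact: cvg_unique h1 h2.
Qed.

End block_orthogonal_operator.

Section walsh_operator.
Context (R : realType).

Definition walsh0 (j l : nat) : R := walsh R j.+1 l.+1.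

(** Labels start at 1 and indices at 0: the labels of level below [n] are the indices below 2^n -
    1. *)
Let bd n := (2 ^ n).-1.

Let bdE n : (bd n).+1 = (2 ^ n)%N.
Proof. by rewrite prednK// expn_gt0. Qed.

Lemma sum_shift (F : nat -> R) n :
  \sum_(l < bd n) F l.+1 = \sum_(1 <= l < 2 ^ n) F l.
Proof. by rewrite -bdE big_add1 big_mkord. Qed.

Let wC j l : walsh0 j l = walsh0 l j. Proof. exact: walshC. Qed.

Let wbd n : (n <= bd n)%N.
Proof. by rewrite -ltnS bdE ltn_expl. Qed.

Let wsupp n j l : (j < bd n)%N -> (bd n <= l)%N -> walsh0 j l = 0.
Proof.
move=> jn nl; apply: (@walsh_supp _ n); rewrite -bdE ltnS//.
Qed.

Let worth n j m : (j < bd n)%N -> (m < bd n)%N ->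
  \sum_(l < bd n) walsh0 j l * walsh0 l m = (j == m)%:R.
Proof.
move=> jn mn; rewrite (sum_shift (fun l => walsh R j.+1 l * walsh R l m.+1)).
by rewrite walsh_orth ?eqSS// -bdE ltnS.
Qed.

Definition walshop : boundedOp (ell2H R) := hop wC wbd wsupp worth.

Lemma walshopK u : walshop (walshop u) = u.
Proof. exact: hopK. Qed.

Lemma walshop_selfadjoint u v :
  dotp (ell2H R) (walshop u) v = dotp (ell2H R) u (walshop v).
Proof. exact: hop_selfadjoint. Qed.

Lemma walshopE (u : ell2H R) j : (walshop u : ell2 R) j =
  \sum_(l < (2 ^ j.+1).-1) (walsh0 j l)%:C%C * (u : ell2 R) l.
Proof. by []. Qed.

End walsh_operator.

(** * Singular values *)

Section schatten_theory.
Context (R : realType) (H : hilbertType R).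
Implicit Types (S T K : boundedOp H).

Lemma opZ S (c : R[i]) (u : H) : S (c *: u) = c *: S u.
Proof. exact: linearZ. Qed.

Lemma opnorm_ge S (u : H) : rnorm u <= 1 -> rnorm (S u) <= opnorm S.
Proof.
move=> u1; apply: ub_le_sup; last by exists u.
have [c hc] := opfunP S; exists `|c| => _ [v /= v1 <-].
apply: le_trans (hc v) _; apply: le_trans (ler_norm _) _.
by rewrite normrM [X in _ * X]ger0_norm ?rnorm_ge0// ler_piMr.
Qed.

Lemma opnorm_ge0 S : 0 <= opnorm S.
Proof.
by rewrite -(@rnorm0 _ H) -(raddf0 S); apply: opnorm_ge; rewrite rnorm0.
Qed.

Lemma singular_value_ge T n (c : R) :
  (forall K, rank_le n K ->
    exists u, [/\ rnorm u <= 1, K u = 0 & c <= rnorm (T u)]) ->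
  c <= singular_value T n.
Proof.
move=> hc; apply: lb_le_inf.
  (* The zero operator shows that the infimum is over a nonempty set, without which a lower bound
     says nothing about [inf]. *)
  exists (opnorm (subop T (zeroop H))), (zeroop H) => //.
  exists (fun=> 0) => u; exists (fun=> 0).
  by rewrite big1// => i _; rewrite scaler0.
move=> _ [K /hc [u [u1 Ku cT]] <-].
rewrite (le_trans cT)// -[T u]subr0 -Ku.
exact: (opnorm_ge (subop T K)).
Qed.

Lemma singular_value_ge0 T n : 0 <= singular_value T n.
Proof.
apply: singular_value_ge => K _; exists 0.
by rewrite !raddf0 !rnorm0.
Qed.

Lemma singular_value_rank_le T n : rank_le n T -> singular_value T n = 0.
Proof.
move=> rT; apply/eqP; rewrite eq_le singular_value_ge0 andbT.
have -> : 0 = opnorm (fun u => T u - T u).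
  rewrite /opnorm (_ : [set _ | _ in _] = [set 0]) ?sup1//.
  apply/seteqP; split=> [_ [u _ <-]|_ ->]; first by rewrite subrr rnorm0.
  by exists 0; rewrite /= ?rnorm0// subrr rnorm0.
apply: ge_inf; last by exists T.
by exists 0 => _ [K _ <-]; exact: (opnorm_ge0 (subop T K)).
Qed.

(** All singular values after the first vanish, and so do their powers because [p] is nonzero; one
    finite term remains. *)
Lemma schatten_rank1 (p : R) (w v : H) : 0 < p -> schatten p (rank1op w v).
Proof.
move=> p0; rewrite /schatten (nneseries_split 0 1); last first.
  by move=> k _; rewrite lee_fin powR_ge0.
rewrite eseries0 ?adde0; last first.
  case=> // n _ _; rewrite singular_value_rank_le ?powR0 ?gt_eqF//.
  exists (fun=> w) => u; exists (fun i => if i == ord0 then dotp H u v else 0).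
  rewrite (bigD1 ord0)//= big1 ?addr0// => i /negbTE ->.
  by rewrite scale0r.
by rewrite add0n big_nat1 ltry.
Qed.

(** The images of n + 1 vectors lie in the span of n vectors; their coefficient matrix has more rows
    than columns, hence a nonzero left kernel. *)
Lemma rank_le_ker n K (f : 'I_n.+1 -> H) : rank_le n K ->
  exists2 x : 'rV[R[i]]_n.+1, x != 0 & K (\sum_k x 0 k *: f k) = 0.
Proof.
move=> [e /= eK]; have [c cP] := choice (fun k => eK (f k)).
pose A : 'M[R[i]]_(n.+1, n) := \matrix_(k, i) c k i.
have : kermx A != 0.
  by rewrite kermx_eq0 -row_leq_rank -ltnNge ltnS rank_leq_col.
case/rowV0Pn => x /sub_kermxP xA x0; exists x => //.
rewrite raddf_sum.
rewrite (eq_bigr (fun k => \sum_i x 0 k *: (c k i *: e i))); last first.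
  by move=> k _; rewrite -scaler_sumr -cP; exact: opZ.
rewrite exchange_big big1//= => i _.
under eq_bigr => k _ do rewrite scalerA; rewrite -scaler_suml.
have := congr1 (fun B : 'rV_n => B 0 i) xA; rewrite !mxE => E.
rewrite (_ : \sum__ _ = 0) ?scale0r// -[RHS]E.
by apply: eq_bigr => k _; rewrite mxE.
Qed.

End schatten_theory.

(** * Diagonal operators and the harmonic series *)

Section schatten_diagonal.
Context (R : realType).

Definition deltaseq (k l : nat) : R[i] := (l == k)%:R.

Lemma square_summable_delta k : deltaseq k \in @ell2_pred R.
Proof.
rewrite inE; exists 1 => n.
rewrite (_ : psum2 _ _ = (k < n)%:R) ?lern1 ?leq_b1//.
elim: n => [|n IH]; first by rewrite /psum2 big_ord0.
rewrite /psum2 big_ord_recr/= -/(psum2 _ n) IH /deltaseq.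
rewrite [(k < n.+1)%N]ltnS [(k <= n)%N]leq_eqVlt eq_sym.
have [->|] := eqVneq k n.
  by rewrite ltnn rnorm1 expr1n add0r.
by rewrite rnorm0 expr0n addr0.
Qed.

Definition delta k : ell2H R := Ell2 (square_summable_delta k).

(** The span of the first n + 1 basis vectors contains a nonzero vector killed by [K]; there the
    diagonal operator expands norms by at least [d n], since [d] is nonincreasing. *)
Lemma singular_value_diag (d : nat -> R)
    (d1 : forall k, rnorm (d k)%:C%C <= 1) :
  (forall k, 0 <= d k) -> nonincreasing_seq d ->
  forall n, d n <= singular_value (diagop d1) n.
Proof.
move=> d0 dni n; apply: singular_value_ge => K.
move=> /(rank_le_ker (fun k => delta k))[x x0]; set u := \sum_k _ => Ku0.
have uE l : (u : ell2 R) l = \sum_(k < n.+1) x 0 k * (l == k)%:R.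
  by rewrite /u; elim/big_ind2 : _ => // a b c e <- <-.
have u0 : u != 0.
  apply: contra_neq x0 => u0; apply/rowP => k; rewrite mxE.
  have := uE k; rewrite u0 (bigD1 k)//= eqxx mulr1 big1 ?addr0 => [<-//|i].
  by rewrite -val_eqE/= eq_sym => /negbTE ->; rewrite mulr0.
have nu0 : 0 < rnorm u by rewrite lt_def rnorm_eq0 u0 rnorm_ge0.
have du : d n * rnorm u <= rnorm (diagop d1 u).
  rewrite -(@ler_pXn2r _ 2%N) ?nnegrE ?rnorm_ge0 ?mulr_ge0 ?rnorm_ge0//.
  have -> : d n * rnorm u = l2norm ((d n)%:C%C *: (u : ell2 R)).
    by rewrite l2normZ rnormR ger0_norm.
  apply: l2norm_le => m; apply: le_trans (psum2_le (diagop d1 u) m).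
  apply: ler_sum => l _.
  rewrite ell2Z diagE !rnormM !exprMn !rnormR !ger0_norm//.
  have [ln|nl] := leqP l n.
    by rewrite ler_wpM2r ?sqr_ge0// ler_pXn2r ?nnegrE//; exact: dni.
  rewrite uE big1 ?rnorm0 ?expr0n ?mulr0// => k _.
  by rewrite gtn_eqF ?mulr0// (leq_ltn_trans _ nl)// -ltnS.
exists ((rnorm u)^-1%:C%C *: u); split.
- by rewrite rnormZ rnormR ger0_norm ?invr_ge0 ?rnorm_ge0// mulVf ?gt_eqF.
- by rewrite opZ Ku0 scaler0.
rewrite opZ rnormZ rnormR ger0_norm ?invr_ge0 ?rnorm_ge0//.
by rewrite ler_pdivlMl// mulrC.
Qed.

Lemma not_schatten_diag (p : R) (d : nat -> R)
    (d1 : forall k, rnorm (d k)%:C%C <= 1) :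
  0 < p -> (forall k, 0 <= d k) -> nonincreasing_seq d ->
  (forall k, harmonic k <= d k `^ p) -> ~ schatten p (diagop d1).
Proof.
move=> p0 d0 dni dp; rewrite /schatten.
set S := (X in (X < _)%E) => Soo.
have S0 : (0 <= S)%E by apply: nneseries_ge0 => k _ _; rewrite lee_fin powR_ge0.
have Sfin : S \is a fin_num by rewrite ge0_fin_numE.
apply: (@dvg_harmonic R); apply: nondecreasing_is_cvgn.
  by apply/nondecreasing_seqP => n; rewrite /series/= big_nat_recr//= lerDl.
exists (fine S) => _ [n _ <-]; rewrite -lee_fin fineK// /series/= -sumEFin.
apply: (@le_trans _ _
  (\sum_(0 <= k < n) (singular_value (diagop d1) k `^ p)%:E)%E).
  apply: lee_sum => k _; rewrite lee_fin (le_trans (dp k))//.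
  rewrite ge0_ler_powR ?nnegrE ?(ltW p0)// ?singular_value_ge0//.
  exact: singular_value_diag.
by apply: nneseries_lim_ge => k _ _; rewrite lee_fin powR_ge0.
Qed.

End schatten_diagonal.

(** * The triple operator integral *)

Section double_sums.
Context (R : realType).
Implicit Types f : nat -> nat -> R[i].

Lemma double_psum_diag f n : (forall j k, j != k -> f j k = 0) ->
  double_psum f n = \sum_(j < (minn n.1 n.2).+1) f j j.
Proof.
case: n => n m f0; rewrite /double_psum /=.
have fS (j : 'I_n.+1) :
    \sum_(k < m.+1) f j k = if (j < m.+1)%N then f j j else 0.
  case: ifPn => [jm|]; last first.
    rewrite -leqNgt => mj; rewrite big1// => k _; rewrite f0// gtn_eqF//.
    by apply: leq_trans mj.
  rewrite (bigD1 (Ordinal jm))//= big1 ?addr0// => k.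
  by rewrite -val_eqE/= => kj; rewrite f0// eq_sym.
under eq_bigr => j _ do rewrite fS.
rewrite -big_mkcond/= (big_ord_widen n.+1 (fun j => f j j)) ?ltnS ?geq_minl//.
apply: eq_bigl => j.
by have := ltn_ord j; lia.
Qed.

(** A rectangular sum of a diagonal array sees only the smaller of its two bounds, and this minimum
    tends to infinity when both bounds do. *)
Lemma cvg_double_psum f (l : R[i]) : (forall j k, j != k -> f j k = 0) ->
  \sum_(j < n.+1) f j j @[n --> \oo] --> l ->
  double_psum f @ (\oo, \oo) --> l.
Proof.
move=> f0 fl; rewrite (_ : double_psum f =
    (fun n => \sum_(j < n.+1) f j j) \o (fun n : nat * nat => minn n.1 n.2)).
  apply: cvg_comp fl => A [N _ NA].
  exists ([set n | (N <= n)%N], [set n | (N <= n)%N]) => /=.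
    by split; exists N.
  by move=> [n m] /= [Nn Nm]; apply: NA => /=; rewrite leq_min Nn.
by apply/funext => n /=; exact: double_psum_diag.
Qed.

Lemma cvg_sum_single (a : nat -> R[i]) t : (forall j, j != t -> a j = 0) ->
  \sum_(j < n) a j @[n --> \oo] --> a t.
Proof.
move=> a0; apply: cvg_near_cst; exists t.+1 => // n /= tn.
rewrite (bigD1 (Ordinal tn))//= big1 ?addr0// => j.
by rewrite -val_eqE/= => /a0.
Qed.

End double_sums.

(** * The operators and symbols of the counterexample *)

Section counterexample.
Context (R : realType) (p : R).
Hypotheses (hp1 : 1 <= p) (hp2 : p < 2).
Let H := ell2H R.

Let p0 : 0 < p. Proof. exact: lt_le_trans hp1. Qed.

Definition ratio : R := 2 `^ (- p^-1).

Lemma ratio_gt0 : 0 < ratio. Proof. exact: powR_gt0. Qed.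

Lemma ratio_le1 : ratio <= 1.
Proof.
rewrite -(powRr0 2) ler_powR ?ler1n//.
by rewrite oppr_le0 invr_ge0 ltW.
Qed.

(** The exponent of 2 is 1/2 - 1/p, negative because p < 2. This is what makes the weights square
    summable. *)
Lemma ratio_sqrt2 : ratio * Num.sqrt 2 < 1.
Proof.
rewrite -powR12_sqrt// -powRD ?pnatr_eq0 ?implybT//.
rewrite /powR pnatr_eq0/= expR_lt1 pmulr_llt0 ?ln_gt0 ?ltr1n// addrC subr_lt0.
by rewrite ltf_pV2 ?posrE.
Qed.

Lemma ratioX_powR n : (ratio ^+ n) `^ p = (2 ^+ n)^-1.
Proof.
rewrite -powR_mulrn ?(ltW ratio_gt0)// /ratio -!powRrM -powR_mulrn// -powRN.
by congr (_ `^ _); field; rewrite gt_eqF.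
Qed.

(** Chosen so that sqrt 2 times [weight], the growth per level of the absolute row sums, times
    [weight] once more is [ratio]. *)
Definition weight : R := Num.sqrt (ratio / Num.sqrt 2).

Lemma sqr_weight : weight ^+ 2 = ratio / Num.sqrt 2.
Proof. by rewrite sqr_sqrtr// divr_ge0 ?sqrtr_ge0// ltW// ratio_gt0. Qed.

Lemma sqr_weight2 : weight ^+ 2 * 2 < 1.
Proof.
by rewrite sqr_weight -{2}[2](@sqr_sqrtr R)// expr2 mulrA divfK ?ratio_sqrt2//.
Qed.

Definition weightseq (k : nat) : R[i] := (weight ^+ level k.+1)%:C%C.

Lemma square_summable_weight : weightseq \in @ell2_pred R.
Proof.
rewrite inE; exists ((1 - weight ^+ 2 * 2)^-1) => n.
apply: (@le_trans _ _ (psum2 weightseq (2 ^ n).-1)).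
  have h : (n <= (2 ^ n).-1)%N by have := @ltn_expl 2 n isT; lia.
  by apply: psum2_nd; exact: h.
rewrite /psum2; under eq_bigr => k _ do
  rewrite rnormR ger0_norm ?exprn_ge0 ?sqrtr_ge0// -exprM mulnC exprM.
rewrite (sum_shift (fun k => (weight ^+ 2) ^+ level k)).
by apply: sum_level; [exact: sqr_ge0|exact: sqr_weight2].
Qed.

Definition weightvec : H := Ell2 square_summable_weight.

Definition cyclic : H := walshop R weightvec.

Definition diagW (k : nat) : R := ratio ^+ level k.+1.

Lemma diagW_ge0 k : 0 <= diagW k.
Proof. by rewrite exprn_ge0// ltW// ratio_gt0. Qed.

Lemma diagW_le1 k : rnorm (diagW k)%:C%C <= 1.
Proof.
rewrite rnormR ger0_norm ?diagW_ge0//.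
by rewrite exprn_ile1 ?ratio_le1// ltW// ratio_gt0.
Qed.

Lemma diagW_ni : nonincreasing_seq diagW.
Proof.
move=> m n mn; rewrite /diagW ler_wiXn2l ?ratio_le1 ?(ltW ratio_gt0)//.
by apply: leq_trunc_log; rewrite ltnS.
Qed.

(** By [ratioX_powR] the right side is 2^(-n) with n the level of [k.+1], and 2^n is at most k +
    1. *)
Lemma harmonic_diagW k : harmonic k <= diagW k `^ p.
Proof.
rewrite ratioX_powR lef_pV2 ?posrE ?exprn_gt0// -natrX ler_nat.
exact: trunc_logP.
Qed.

Definition opW : boundedOp H := diagop diagW_le1.

Lemma not_schatten_opW : ~ schatten p opW.
Proof.
apply: not_schatten_diag => //; [exact: diagW_ge0|exact: diagW_ni|].
exact: harmonic_diagW.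
Qed.

Definition opQ : boundedOp H := rank1op cyclic weightvec.

Definition measure1 : spectralMeasure H :=
  @atomic_measure R (idop H) (fun _ => erefl) (fun _ _ => erefl).

Definition measure2 : spectralMeasure H :=
  atomic_measure (@walshopK R) (@walshop_selfadjoint R).

Definition Spos (j : nat) : set R :=
  [set l%:R | l in [set l | 0 < walsh0 R j l]].

Definition Sneg (j : nat) : set R :=
  [set l%:R | l in [set l | walsh0 R j l < 0]].

Lemma measurable_natr (D : set nat) : measurable [set (l%:R : R) | l in D].
Proof.
rewrite -bigcup_imset1; apply: bigcup_measurable => l _.
exact: measurable_set1.
Qed.

Lemma measurable_Spos j : measurable (Spos j).
Proof. exact: measurable_natr. Qed.

Lemma measurable_Sneg j : measurable (Sneg j).
Proof. exact: measurable_natr. Qed.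

Lemma natr_image (D : set nat) l :
  (l%:R \in [set (m%:R : R) | m in D]) = (l \in D).
Proof.
apply/idP/idP; rewrite !inE; last by move=> Dl; exists l.
by move=> [m Dm /eqP]; rewrite eqr_nat => /eqP <-.
Qed.

Definition alpha (j : nat) : R -> R[i] := indic_diff [set j%:R] set0.

Definition betaS (j k : nat) := if j == k then Spos j else set0.
Definition betaT (j k : nat) := if j == k then Sneg j else set0.

Definition beta (j k : nat) : R -> R[i] := indic_diff (betaS j k) (betaT j k).

(** At [x1] only the index [Num.truncn x1] can have a nonzero [alpha], so the double series reduces
    to this single term. *)
Definition Phi (x1 x2 x3 : R) : R[i] :=
  let t := Num.truncn x1 in alpha t x1 * beta t t x2 * alpha t x3.

Lemma cmeasurable_indic_diff (S T : set R) :
  measurable S -> measurable T -> cmeasurable (indic_diff S T).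
Proof.
move=> mS mT; split; last exact: measurable_cst.
by apply: measurable_funB; exact: measurable_indic.
Qed.

Lemma alphaE j x : alpha j x = (x == j%:R)%:R.
Proof.
rewrite /alpha /indic_diff !indicE in_set0 subr0 rmorph_nat.
by congr (nat_of_bool _)%:R; apply/idP/eqP; rewrite inE.
Qed.

Lemma alpha_eq0 j x : j != Num.truncn x -> alpha j x = 0.
Proof. by rewrite alphaE; case: (x =P j%:R) => // ->; rewrite natrK eqxx. Qed.

Lemma beta_offdiag j k x : j != k -> beta j k x = 0.
Proof.
by rewrite /beta /betaS /betaT => /negbTE ->; rewrite /indic_diff subrr.
Qed.

Lemma rnorm_beta j k x : rnorm (beta j k x) <= 1.
Proof.
rewrite /beta /indic_diff rnormR !indicE.
by case: (_ \in _); case: (_ \in _);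
  rewrite ?subrr ?sub0r ?subr0 ?normrN ?normr0 ?normr1.
Qed.

Lemma Linfty_alpha : Linfty_l2 measure1 alpha.
Proof.
split=> [j|]; first exact: cmeasurable_indic_diff.
exists 1; exists set0; split; first by split=> // u; exact: spm_set0.
move=> x _ /=; rewrite /l2norm2.
have -> : (\sum_(0 <= k <oo) (rnorm (alpha k x) ^+ 2)%:E =
    \sum_(0 <= k < (Num.truncn x).+1) (rnorm (alpha k x) ^+ 2)%:E)%E.
  rewrite (nneseries_split 0 (Num.truncn x).+1)/=; last first.
    by move=> k _; rewrite lee_fin sqr_ge0.
  rewrite eseries0 ?adde0// => k; rewrite add0n => tk _.
  by rewrite alpha_eq0 ?rnorm0 ?expr0n// gtn_eqF.
rewrite big_nat_recr//= big_nat big1 => [|k /andP[_ kt]].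
  rewrite add0e lee_fin alphaE; case: eqP => _; last by rewrite rnorm0 expr0n.
  by rewrite rnorm1 expr1n.
by rewrite alpha_eq0 ?rnorm0 ?expr0n// ltn_eqF.
Qed.

(** At every point the matrix is diagonal with entries of modulus at most 1, hence a contraction;
    the exceptional null set is empty. *)
Lemma Linfty_beta : Linfty_B measure2 beta.
Proof.
split=> [j k|].
  by apply: cmeasurable_indic_diff; rewrite /betaS /betaT; case: eqP => // _;
    [exact: measurable_Spos|exact: measurable_Sneg].
exists 1; exists set0; split; first by split=> // u; exact: spm_set0.
move=> x _ /= a a2; exists (fun j => beta j j x * a j); split.
  move=> j; apply: cvg_near_cst; exists j.+1 => // n /= jn.
  rewrite /series/= big_mkord (bigD1 (Ordinal jn))//= big1 ?addr0// => k.
  by rewrite -val_eqE/= eq_sym => kj; rewrite beta_offdiag ?mul0r.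
rewrite expr1n mul1e; apply: lee_nneseries => k _.
  by rewrite lee_fin sqr_ge0.
rewrite lee_fin rnormM exprMn ler_piMl ?sqr_ge0//.
by rewrite -(expr1n _ 2) ler_pXn2r ?nnegrE ?rnorm_ge0 ?rnorm_beta.
Qed.

Lemma haagerup_expansion_Phi :
  haagerup_expansion measure1 measure2 measure1 alpha beta alpha Phi.
Proof.
split; [exact: Linfty_alpha|exact: Linfty_beta|exact: Linfty_alpha|].
exists set0, set0, set0; split; try by split=> // u; exact: spm_set0.
move=> x1 x2 x3 _ _ _; apply: cvg_double_psum => [j k jk|].
  by rewrite beta_offdiag// mulr0 mul0r.
have := @cvg_sum_single R (fun j => alpha j x1 * beta j j x2 * alpha j x3)
  (Num.truncn x1).
rewrite -(cvg_shiftS (fun n : nat => _)); apply => j jt.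
by rewrite alpha_eq0 ?mul0r.
Qed.

Definition opA (j : nat) : boundedOp H :=
  subop (measure1 [set j%:R]) (measure1 set0).

Definition opB (j k : nat) : boundedOp H :=
  subop (measure2 (betaS j k)) (measure2 (betaT j k)).

Lemma opAE j (u : H) l : (opA j u : ell2 R) l = (l == j)%:R * (u : ell2 R) l.
Proof.
rewrite (_ : (opA j u : ell2 R) l =
  atoms [set j%:R] l * (u : ell2 R) l - atoms set0 l * (u : ell2 R) l)//.
rewrite /atoms !indicE in_set0 mul0r subr0; congr ((nat_of_bool _)%:R * _).
by apply/idP/eqP; rewrite inE/=; [move/eqP; rewrite eqr_nat => /eqP|move=> ->].
Qed.

Lemma dot_single (u v : H) j : (forall l, l != j -> (u : ell2 R) l = 0) ->
  dotp H u v = (u : ell2 R) j * ((v : ell2 R) j)^*.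
Proof.
move=> u0; apply: l2dot_unique.
apply: (@cvg_sum_single R (fun l => (u : ell2 R) l * ((v : ell2 R) l)^*)).
by move=> l /u0 ->; rewrite mul0r.
Qed.

Lemma dot_opA j (u v : H) :
  dotp H (opA j u) v = (u : ell2 R) j * ((v : ell2 R) j)^*.
Proof.
rewrite (@dot_single _ _ j) => [|l /negbTE lj].
  by rewrite opAE eqxx mul1r.
by rewrite opAE lj mul0r.
Qed.

Lemma opB_cyclic j : (opB j j cyclic : ell2 R) j =
  ((Num.sqrt 2 * weight) ^+ level j.+1)%:C%C.
Proof.
(* The inner [walshop] undoes the one in [cyclic], so the coordinate projection acts directly on the
   weights. *)
have projV (A : set R) : (measure2 A cyclic : ell2 R) j =
    \sum_(l < (2 ^ j.+1).-1) (walsh0 R j l)%:C%C * (atoms A l * weightseq l).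
  rewrite (_ : measure2 A cyclic =
    walshop R (coordproj A (walshop R cyclic)))//.
  by rewrite walshopE walshopK.
rewrite /opB /betaS /betaT eqxx.
rewrite (_ : (subop (measure2 (Spos j)) (measure2 (Sneg j)) cyclic : ell2 R) j
  = (measure2 (Spos j) cyclic : ell2 R) j
    - (measure2 (Sneg j) cyclic : ell2 R) j)//.
rewrite !projV -sumrB -(@walsh_abs_sum R _ j.+1); last first.
  by rewrite /=; apply: ltn_expl.
rewrite -sum_shift rmorph_sum/=; apply: eq_bigr => l _.
rewrite /atoms !indicE !natr_image /weightseq -mulrBr -mulrBl.
rewrite -!(rmorph_nat (real_complex R)) -rmorphB -!rmorphM /=; congr (_%:C%C).
rewrite mulrA; congr (_ * _); rewrite -/(walsh0 R j l).
(* An entry times its sign is its absolute value; a zero entry contributes nothing to either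
   side. *)
have [h|h|h] := ltrgt0P (walsh0 R j l).
- by rewrite mem_set// memNset ?subr0 ?mulr1//= ltNge ltW.
- by rewrite memNset ?mem_set ?sub0r ?mulrN1//= ltNge ltW.
- by rewrite h mul0r.
Qed.

(** At level n, [opQ] contributes the weight r^n and [opB_cyclic] the factor (sqrt 2 r)^n; their
    product is the entry [ratio ^+ n] of [opW]. *)
Lemma triple_term j (u v : H) : dotp H (opA j (opB j j (opQ (opA j u)))) v =
  (opW u : ell2 R) j * ((v : ell2 R) j)^*.
Proof.
rewrite dot_opA; congr (_ * _).
rewrite (_ : opQ (opA j u) = dotp H (opA j u) weightvec *: cyclic)// dot_opA.
rewrite opZ ell2Z opB_cyclic diagE /= -mulrA [RHS]mulrC; congr (_ * _).
rewrite -[Num.conj _]/(conjc _) conjc_real -(rmorphM (real_complex R)) -exprMn.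
congr (_ ^+ _)%:C%C.
by rewrite mulrCA -expr2 sqr_weight mulrC divfK//.
Qed.

(** Off the diagonal [opB] vanishes; by [triple_term] the diagonal terms add up to the partial sums
    of the inner product of [opW u] and [v]. *)
Lemma triple_integral_opW :
  is_triple_integral measure1 measure2 measure1 Phi (idop H) opQ opW.
Proof.
exists alpha, beta, alpha; split; first exact: haagerup_expansion_Phi.
exists opA, opB, opA; split.
- by move=> j; exact: is_spectral_integral_indic_diff.
- move=> j k; apply: is_spectral_integral_indic_diff; rewrite /betaS /betaT;
    case: eqP => // _; [exact: measurable_Spos|exact: measurable_Sneg].
- by move=> j; exact: is_spectral_integral_indic_diff.
move=> u v; apply: cvg_double_psum => [j k jk|].
  rewrite (_ : opB j k _ = 0) ?raddf0 ?dot0l//=.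
  by rewrite /betaS /betaT (negbTE jk) subrr.
under eq_fun do under eq_bigr do rewrite triple_term.
have := @l2dot_cvg R (opW u) v; rewrite -cvg_shiftS; exact.
Qed.

End counterexample.

Theorem theorem9p1 (R : realType) (p : R) (hp1 : 1 <= p) (hp2 : p < 2) :
  exists (H : hilbertType R) (E1 E2 E3 : spectralMeasure H)
    (Phi : R -> R -> R -> R[i]) (Q W : boundedOp H),
    [/\ haagerup E1 E2 E3 Phi,
        schatten p Q,
        is_triple_integral E1 E2 E3 Phi (idop H) Q W &
        ~ schatten p W].
Proof.
exists (ell2H R), (measure1 R), (measure2 R), (measure1 R), (@Phi R).
exists (opQ hp1 hp2), (opW hp1); split.
- by exists (@alpha R), (@beta R), (@alpha R); exact: haagerup_expansion_Phi.
- by apply: schatten_rank1; exact: lt_le_trans hp1.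
- exact: triple_integral_opW.
- exact: not_schatten_opW.
Qed.
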